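(* Suppose the assumptions on $f$ and $g$ listed in the context hold ($\ell$ is not assumed convex). Fix $c\in(0,1)$ and run the IBCG algorithm for $K\ge1$ iterations with $\alpha=2/(\mu_g+L_g)$, $\eta_k=\eta=c\,\frac{1-\beta}{\mu_g}$ and constant $\gamma_k=\gamma$ as specified below. (a) Let $\gamma=\kappa_g^{-2.5}K^{-0.5}$. There is a constant $C>0$, depending only on $c$, $L_g$, $L^f_{xx},L^f_{xy},L^f_{yx},L^f_{yy}$, $C^g_{yx},L^g_{yx},L^g_{yy}$, $D_{\mathcal X}$, $\|\mathbf y_0-\mathbf y^*(\mathbf x_0)\|$, $\|\mathbf w_0\|$, $\ell(\mathbf x_0)-\ell(\mathbf x^* )$ and $\|\nabla_y f(\mathbf x^*,\mathbf y^*(\mathbf x^* ))\|$ (in particular not on $\kappa_g$ or $\epsilon$), such that for every $\epsilon\in(0,1]$ there is an integer $K\le C\,\kappa_g^5\,\epsilon^{-2}$ for which the algorithm run with this $K$ produces an iterate $\mathbf x_{k^*}$, $k^*\in\{0,1,\dots,K-1\}$, with $\mathcal G(\mathbf x_{k^*})\le\epsilon$. That is, $\mathcal G(\mathbf x_{k^*})\le\epsilon$ after $\mathcal O(\kappa_g^5\epsilon^{-2})$ iterations. (b) If in addition there is $M\ge0$ with $\|\nabla_y f(\mathbf x,\mathbf y)\|\le M$ for all $\mathbf x\in\mathcal X$, $\mathbf y\in\mathbb R^m$, then with $\gamma=\kappa_g^{-2}K^{-0.5}$ the same conclusion holds with $\kappa_g^5$ replaced by $\kappa_g^4$, where $C$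 may now also depend on $M$. That is, $\mathcal G(\mathbf x_{k^*})\le\epsilon$ after $\mathcal O(\kappa_g^4\epsilon^{-2})$ iterations.
   Context: Norms are Euclidean for vectors and spectral for matrices. Let $n,m\ge 1$ be integers and $\mathcal X\subset\mathbb R^n$ a nonempty compact convex set of diameter $D_{\mathcal X}$, i.e. $\|\mathbf x-\bar{\mathbf x}\|\le D_{\mathcal X}$ for all $\mathbf x,\bar{\mathbf x}\in\mathcal X$. Let $f,g:\mathcal X\times\mathbb R^m\to\mathbb R$ be continuously differentiable (on an open set containing $\mathcal X\times\mathbb R^m$). Assumption on $f$: for all $\mathbf x,\bar{\mathbf x}\in\mathcal X$, $\mathbf y,\bar{\mathbf y}\in\mathbb R^m$: $\|\nabla_x f(\mathbf x,\mathbf y)-\nabla_x f(\bar{\mathbf x},\bar{\mathbf y})\|\le L^f_{xx}\|\mathbf x-\bar{\mathbf x}\|+L^f_{xy}\|\mathbf y-\bar{\mathbf y}\|$ and $\|\nabla_y f(\mathbf x,\mathbf y)-\nabla_y f(\bar{\mathbf x},\bar{\mathbf y})\|\le L^f_{yx}\|\mathbf x-\bar{\mathbf x}\|+L^f_{yy}\|\mathbf y-\bar{\mathbf y}\|$. Assumption on $g$: (i) $g(\mathbf x,\cdot)$ is twice continuously differentiable for each $\mathbf x\in\mathcal X$, and $\nabla_y g(\cdot,\cdot)$ is continuously differentiable; (ii) $\nabla_y g(\mathbf x,\cdot)$ is $L_g$-Lipschitz for each $\mathbf x\in\mathcal X$, and $\nabla_y g(\cdot,\mathbf y)$ is $C^g_{yx}$-Lipschitz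 for each $\mathbf y\in\mathbb R^m$; consequently (as the paper records) $\|\nabla^2_{yx}g(\mathbf x,\mathbf y)\|\le C^g_{yx}$ on $\mathcal X\times\mathbb R^m$; (iii) $g(\mathbf x,\cdot)$ is $\mu_g$-strongly convex for each $\mathbf x\in\mathcal X$, $\mu_g>0$; (iv) $\nabla^2_{yx}g$ (with values in $\mathbb R^{n\times m}$, entries $\partial^2 g/\partial x_i\partial y_j$) and $\nabla^2_{yy}g$ are Lipschitz in $(\mathbf x,\mathbf y)\in\mathcal X\times\mathbb R^m$ with constants $L^g_{yx}$, $L^g_{yy}$, i.e. the norm of the difference of values at $(\mathbf x,\mathbf y)$ and $(\bar{\mathbf x},\bar{\mathbf y})$ is at most the constant times $\|\mathbf x-\bar{\mathbf x}\|+\|\mathbf y-\bar{\mathbf y}\|$. Bilevel problem: $\mathbf y^*(\mathbf x)$ is the unique minimizer of $g(\mathbf x,\cdot)$, $\ell(\mathbf x)=f(\mathbf x,\mathbf y^*(\mathbf x))$ for $\mathbf x\in\mathcal X$, and $\mathbf x^*$ is a minimizer of $\ell$ over $\mathcal X$. The gradient of $\ell$ is $\nabla\ell(\mathbf x)=\nabla_x f(\mathbf x,\mathbf y^*(\mathbf x))-\nabla^2_{yx}g(\mathbf x,\mathbf y^*(\mathbf x))[\nabla^2_{yy}g(\mathbf x,\mathbf y^*(\mathbf x))]^{-1}\nabla_y f(\mathbf x,\mathbf y^*(\mathbf x))$. The Frank–Wolfe gap is $\mathcal G(\mathbf x)=\max_{\mathbf s\in\mathcal X}\langle\nabla\ell(\mathbf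 x),\mathbf x-\mathbf s\rangle$. $\kappa_g=L_g/\mu_g$ and $\beta=(L_g-\mu_g)/(L_g+\mu_g)$. IBCG algorithm: given $\gamma_k\in[0,1]$, $\eta_k\ge0$, $\alpha>0$, $\mathbf x_0\in\mathcal X$, $\mathbf y_0\in\mathbb R^m$, set $\mathbf w_0=\mathbf y_0$ and for $k=0,1,\dots,K-1$: $\mathbf w_{k+1}=(I-\eta_k\nabla^2_{yy}g(\mathbf x_k,\mathbf y_k))\mathbf w_k+\eta_k\nabla_y f(\mathbf x_k,\mathbf y_k)$; $F_k=\nabla_x f(\mathbf x_k,\mathbf y_k)-\nabla^2_{yx}g(\mathbf x_k,\mathbf y_k)\mathbf w_{k+1}$; $\mathbf s_k\in\arg\min_{\mathbf s\in\mathcal X}\langle F_k,\mathbf s\rangle$; $\mathbf x_{k+1}=(1-\gamma_k)\mathbf x_k+\gamma_k\mathbf s_k$; $\mathbf y_{k+1}=\mathbf y_k-\alpha\nabla_y g(\mathbf x_{k+1},\mathbf y_k)$. *)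

(* Defs.v *)
From HB Require Import structures.
From mathcomp Require Import all_boot all_order all_algebra.
From mathcomp Require Import all_classical all_reals all_analysis.

Set Implicit Arguments.
Unset Strict Implicit.
Unset Printing Implicit Defensive.

Import Order.TTheory GRing.Theory Num.Theory.
Import numFieldNormedType.Exports.

Local Open Scope classical_set_scope.
Local Open Scope ring_scope.

(* The library's norm on matrices is the sup norm (it induces the same
   topology as the Euclidean norm, but has different constants), so the
   Euclidean and spectral norms are defined separately. *)
Section EuclideanSpace.
Context {R : realType}.

Definition dot n (u v : 'cV[R]_n) : R := \sum_(i < n) u i 0 * v i 0.

Definition enorm n (u : 'cV[R]_n) : R := Num.sqrt (dot u u).

Definition spnorm m n (A : 'M[R]_(m, n)) : R :=
  sup [set enorm (A *m v) | v in [set v : 'cV[R]_n | enorm v <= 1]].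

Definition gradient n (h : 'cV[R]_n -> R) (p : 'cV[R]_n) : 'cV[R]_n :=
  \col_(i < n) 'D_(delta_mx i 0) h p.

Definition strongly_convex n (mu : R) (h : 'cV[R]_n -> R) : Prop :=
  forall (u v : 'cV[R]_n) (t : R), 0 <= t <= 1 ->
    h ((1 - t) *: u + t *: v)
      <= (1 - t) * h u + t * h v - mu / 2 * t * (1 - t) * enorm (u - v) ^+ 2.

(* For finite-dimensional [V], continuity of every directional derivative is
   continuity of the differential. *)
Definition C1_on (V W : normedModType R) (U : set V) (h : V -> W) : Prop :=
  open U /\
  forall p, U p ->
    differentiable h p /\
    forall v : V, {for p, continuous (fun q => 'D_v h q)}.

End EuclideanSpace.

Section Bilevel.
Context {R : realType} {n m : nat}.
Implicit Types (X : set 'cV[R]_n) (f g : 'cV[R]_n -> 'cV[R]_m -> R).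
Implicit Types (x : 'cV[R]_n) (y : 'cV[R]_m).

Definition grad_x f x y : 'cV[R]_n := gradient (fun x' => f x' y) x.

Definition grad_y f x y : 'cV[R]_m := gradient (f x) y.

Definition hess_yx g x y : 'M[R]_(n, m) :=
  \matrix_(i < n, j < m)
    'D_(delta_mx i 0) (fun x' : 'cV[R]_n => grad_y g x' y j 0) x.

Definition hess_yy g x y : 'M[R]_m :=
  \matrix_(i < m, j < m)
    'D_(delta_mx i 0) (fun y' : 'cV[R]_m => grad_y g x y' j 0) y.

Definition C1_near_domain (W : normedModType R) X
    (h : 'cV[R]_n -> 'cV[R]_m -> W) : Prop :=
  exists U : set ('cV[R]_n * 'cV[R]_m),
    X `*` setT `<=` U /\ C1_on U (fun p => h p.1 p.2).

Record f_assumption X f (Lxx Lxy Lyx Lyy : R) : Prop := {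
  f_C1 : C1_near_domain X f ;
  f_grad_x_lip : forall x x' y y', X x -> X x' ->
    enorm (grad_x f x y - grad_x f x' y')
      <= Lxx * enorm (x - x') + Lxy * enorm (y - y') ;
  f_grad_y_lip : forall x x' y y', X x -> X x' ->
    enorm (grad_y f x y - grad_y f x' y')
      <= Lyx * enorm (x - x') + Lyy * enorm (y - y')
}.

Record g_assumption X g (mu Lg Cyx Lyx Lyy : R) : Prop := {
  g_C1 : C1_near_domain X g ;
  g_C2 : forall x, X x -> C1_on setT (g x) /\ C1_on setT (grad_y g x) ;
  g_grad_y_C1 : C1_near_domain X (grad_y g) ;
  g_grad_y_lip_y : forall x y y', X x ->
    enorm (grad_y g x y - grad_y g x y') <= Lg * enorm (y - y') ;
  g_grad_y_lip_x : forall x x' y, X x -> X x' ->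
    enorm (grad_y g x y - grad_y g x' y) <= Cyx * enorm (x - x') ;
  g_mu_gt0 : 0 < mu ;
  g_strongly_convex : forall x, X x -> strongly_convex mu (g x) ;
  g_hess_yx_lip : forall x x' y y', X x -> X x' ->
    spnorm (hess_yx g x y - hess_yx g x' y')
      <= Lyx * (enorm (x - x') + enorm (y - y')) ;
  g_hess_yy_lip : forall x x' y y', X x -> X x' ->
    spnorm (hess_yy g x y - hess_yy g x' y')
      <= Lyy * (enorm (x - x') + enorm (y - y'))
}.

(* The minimizer exists and is unique when [g x] is continuous and strongly
   convex; only such [x] are ever used. *)
Definition ystar g x : 'cV[R]_m := get [set y | forall y', g x y <= g x y'].

Definition ell f g x : R := f x (ystar g x).

(* [ell] is only meaningful on the feasible set, which may have empty
   interior, so its gradient is given by the implicit-function formula. *)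
Definition grad_ell f g x : 'cV[R]_n :=
  let y := ystar g x in
  grad_x f x y - hess_yx g x y *m invmx (hess_yy g x y) *m grad_y f x y.

(* The supremum is a maximum when [X] is nonempty and compact. *)
Definition fw_gap X f g x : R :=
  sup [set dot (grad_ell f g x) (x - s) | s in X].

Definition ibcg_direction f g x y (w : 'cV[R]_m) : 'cV[R]_n :=
  grad_x f x y - hess_yx g x y *m w.

(* [xs], [ys], [ws] and [ss] hold x_k, y_k, w_k and s_k; the terms beyond the
   first [K] iterations are unconstrained. *)
Record ibcg_run X f g (gamma eta : nat -> R) (alpha : R) (x0 : 'cV[R]_n)
    (y0 : 'cV[R]_m) (K : nat) (xs : nat -> 'cV[R]_n) (ys ws : nat -> 'cV[R]_m)
    (ss : nat -> 'cV[R]_n) : Prop := {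
  run_x0 : xs 0%N = x0 ;
  run_y0 : ys 0%N = y0 ;
  run_w0 : ws 0%N = y0 ;
  run_w : forall k, (k < K)%N ->
    ws k.+1 = (1%:M - eta k *: hess_yy g (xs k) (ys k)) *m ws k
              + eta k *: grad_y f (xs k) (ys k) ;
  run_s_in : forall k, (k < K)%N -> X (ss k) ;
  run_s_min : forall k, (k < K)%N -> forall s, X s ->
    dot (ibcg_direction f g (xs k) (ys k) (ws k.+1)) (ss k)
      <= dot (ibcg_direction f g (xs k) (ys k) (ws k.+1)) s ;
  run_x : forall k, (k < K)%N ->
    xs k.+1 = (1 - gamma k) *: xs k + gamma k *: ss k ;
  run_y : forall k, (k < K)%N ->
    ys k.+1 = ys k - alpha *: grad_y g (xs k.+1) (ys k)
}.

(* The last four scalars are the initial and optimal quantities on which the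
   complexity constant may depend; w_0 = y_0, so [nw0] is the norm of w_0. *)
Record bilevel_setting X f g (mu Lg Lfxx Lfxy Lfyx Lfyy Cgyx Lgyx Lgyy D : R)
    (x0 : 'cV[R]_n) (y0 : 'cV[R]_m) (xstar : 'cV[R]_n)
    (dy0 nw0 dl0 nfy : R) : Prop := {
  dim_x : (0 < n)%N ;
  dim_y : (0 < m)%N ;
  X_nonempty : X !=set0 ;
  X_compact : compact X ;
  X_convex : convex_set X ;
  X_diameter : forall x x', X x -> X x' -> enorm (x - x') <= D ;
  f_ok : f_assumption X f Lfxx Lfxy Lfyx Lfyy ;
  g_ok : g_assumption X g mu Lg Cgyx Lgyx Lgyy ;
  x0_in : X x0 ;
  xstar_in : X xstar ;
  xstar_min : forall x, X x -> ell f g xstar <= ell f g x ;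
  dy0E : enorm (y0 - ystar g x0) = dy0 ;
  nw0E : enorm y0 = nw0 ;
  dl0E : ell f g x0 - ell f g xstar = dl0 ;
  nfyE : enorm (grad_y f xstar (ystar g xstar)) = nfy
}.

End Bilevel.

Section StepSizes.
Context {R : realType}.
Implicit Types mu Lg c : R.

Definition kappa_g mu Lg : R := Lg / mu.
Definition ibcg_beta mu Lg : R := (Lg - mu) / (Lg + mu).
Definition ibcg_alpha mu Lg : R := 2 / (mu + Lg).
Definition ibcg_eta c mu Lg : R := c * ((1 - ibcg_beta mu Lg) / mu).

End StepSizes.

(* Main.v *)
Require Import Defs.
From HB Require Import structures.
From mathcomp Require Import all_boot all_order all_algebra.
From mathcomp Require Import all_classical all_reals all_analysis.
From mathcomp Require Import ring lra.

(** Let v*(x) solve the adjoint system H v = grad_y f at y*(x), H the lower-level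
    Hessian, so that grad ell = grad_x f - (hess_yx g) v*.  A gradient step on
    [g x] contracts by beta, hence so does its linearisation I - alpha H; this
    makes y* and v* Lipschitz and turns the updates of y_k and w_k into
    contractions towards the moving targets y*(x_k) and v*(x_k), with drift of
    order gamma.  Since X may have empty interior, ell is never differentiated:
    its quadratic upper bound comes from subtracting the expansions of grad_y g
    and f at two optimal pairs (x, y*(x)), (x', y*(x')), where grad_y g vanishes.
    Summing the resulting descent inequality and the two error recursions bounds
    the smallest gap by O(q + q^2), q = kappa^2 sqrt (s / K), where
    |grad_y f(x, y*(x))| = O(s): s = kappa in general, and s = 1 when grad_y f is
    bounded. *)

Set Implicit Arguments.
Unset Strict Implicit.
Unset Printing Implicit Defensive.

Import Order.TTheory GRing.Theory Num.Theory.
Import numFieldNormedType.Exports.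

Local Open Scope classical_set_scope.
Local Open Scope ring_scope.

(** * Euclidean and spectral norms *)

Section Euclidean.
Context {R : realType}.

(** Two obstacles shape the estimates. Matrix-valued derivatives are never differentiated or bounded
    directly: for a fixed vector [p] the real function [dot p (grad_y g x y)] has partial gradients
    [hess_yx g x y *m p] and [hess_yy g x y *m p], so one-sided difference quotients and mean values
    of real functions transfer bounds on increments of [grad_y g] to these products by duality, with
    no appeal to symmetry or to the spectrum of the Hessian. The final constant may not depend on
    [mu], although 1/[mu] enters every Lipschitz constant of y* and v*. With [L] fixed, 1/[mu] =
    kappa/[L], so each inverse power of [mu] is paid for by a power of kappa. These powers are
    gathered in two quantities: [tau], of order kappa, for the motion of y*, and [omega], of order s
    kappa, for the size of v*. The descent remainder and the drift of v* both cost
    [tau ^+ 2 * omega], of order s kappa^3; averaging the error recursions adds one more kappa, and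
    this fixes the step size. *)

Lemma dotC n (u v : 'cV[R]_n) : dot u v = dot v u.
Proof. by apply: eq_bigr => i _; rewrite mulrC. Qed.

Lemma dotDl n (u v w : 'cV[R]_n) : dot (u + v) w = dot u w + dot v w.
Proof. by rewrite -big_split /=; apply: eq_bigr => i _; rewrite mxE mulrDl. Qed.

Lemma dotDr n (u v w : 'cV[R]_n) : dot w (u + v) = dot w u + dot w v.
Proof. by rewrite dotC dotDl !(dotC w). Qed.

Lemma dotZl n a (u v : 'cV[R]_n) : dot (a *: u) v = a * dot u v.
Proof. by rewrite mulr_sumr; apply: eq_bigr => i _; rewrite mxE mulrA. Qed.

Lemma dotZr n a (u v : 'cV[R]_n) : dot u (a *: v) = a * dot u v.
Proof. by rewrite dotC dotZl dotC. Qed.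

Lemma dotNl n (u v : 'cV[R]_n) : dot (- u) v = - dot u v.
Proof. by rewrite -scaleN1r dotZl mulN1r. Qed.

Lemma dotNr n (u v : 'cV[R]_n) : dot u (- v) = - dot u v.
Proof. by rewrite dotC dotNl dotC. Qed.

Lemma dotBl n (u v w : 'cV[R]_n) : dot (u - v) w = dot u w - dot v w.
Proof. by rewrite dotDl dotNl. Qed.

Lemma dotBr n (u v w : 'cV[R]_n) : dot w (u - v) = dot w u - dot w v.
Proof. by rewrite dotDr dotNr. Qed.

Lemma dot0l n (u : 'cV[R]_n) : dot 0 u = 0.
Proof. by rewrite -(scale0r (0 : 'cV_n)) dotZl mul0r. Qed.

Lemma dot_ge0 n (u : 'cV[R]_n) : 0 <= dot u u.
Proof. by apply: sumr_ge0 => i _; rewrite -expr2 sqr_ge0. Qed.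

Lemma enorm_ge0 n (u : 'cV[R]_n) : 0 <= enorm u.
Proof. exact: sqrtr_ge0. Qed.

Lemma enorm_sqr n (u : 'cV[R]_n) : enorm u ^+ 2 = dot u u.
Proof. by rewrite sqr_sqrtr // dot_ge0. Qed.

Lemma enormZ n a (u : 'cV[R]_n) : enorm (a *: u) = `|a| * enorm u.
Proof. by rewrite /enorm dotZl dotZr mulrA -expr2 sqrtrM ?sqr_ge0// sqrtr_sqr. Qed.

Lemma enormN n (u : 'cV[R]_n) : enorm (- u) = enorm u.
Proof. by rewrite /enorm dotNl dotNr opprK. Qed.

Lemma enormBC n (u v : 'cV[R]_n) : enorm (u - v) = enorm (v - u).
Proof. by rewrite -enormN opprB. Qed.

Lemma enorm0 n : enorm (0 : 'cV[R]_n) = 0.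
Proof. by rewrite /enorm dot0l sqrtr0. Qed.

Lemma enorm_eq0 n (u : 'cV[R]_n) : (enorm u == 0) = (u == 0).
Proof.
apply/eqP/eqP => [u0|->]; last exact: enorm0.
have /psumr_eq0P h : \sum_i u i 0 * u i 0 = 0.
  by rewrite -[LHS]/(dot u u) -enorm_sqr u0 expr0n.
apply/matrixP => i j; rewrite ord1 mxE; apply/eqP.
by rewrite -sqrf_eq0 expr2 h// => k _; rewrite -expr2 sqr_ge0.
Qed.

Lemma dot_le n (u v : 'cV[R]_n) : dot u v <= enorm u * enorm v.
Proof.
have [/eqP|v0] := eqVneq (enorm v) 0.
  by rewrite enorm_eq0 => /eqP ->; rewrite dotC dot0l enorm0 mulr0.
have vp : 0 < enorm v by rewrite lt0r v0 enorm_ge0.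
have := dot_ge0 (enorm v ^+ 2 *: u - dot u v *: v).
rewrite !(dotBl, dotBr, dotZl, dotZr) (dotC v u) -!enorm_sqr => h.
have h2 : dot u v ^+ 2 <= (enorm u * enorm v) ^+ 2.
  rewrite -(ler_pM2l (exprn_gt0 2 vp)); nra.
apply: le_trans (ler_norm _) _.
rewrite -ler_sqr ?nnegrE ?mulr_ge0 ?enorm_ge0//.
by rewrite real_normK ?num_real.
Qed.

Lemma dot_ge n (u v : 'cV[R]_n) : - (enorm u * enorm v) <= dot u v.
Proof. by rewrite lerNl -dotNl -(enormN u) dot_le. Qed.

Lemma enormD n (u v : 'cV[R]_n) : enorm (u + v) <= enorm u + enorm v.
Proof.
rewrite -ler_sqr ?nnegrE ?addr_ge0 ?enorm_ge0// enorm_sqr !(dotDl, dotDr).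
by rewrite sqrrD !enorm_sqr (dotC v u); have := dot_le u v; lra.
Qed.

Lemma enormB n (u v : 'cV[R]_n) : enorm (u - v) <= enorm u + enorm v.
Proof. by rewrite -(enormN v) enormD. Qed.

Lemma enorm_dist_trans n (v u w : 'cV[R]_n) :
  enorm (u - w) <= enorm (u - v) + enorm (v - w).
Proof. by apply: le_trans (enormD _ _); rewrite addrA subrK. Qed.

(** Duality, tested at [p = u]. It lets a bound on an operator be checked on a bilinear expression,
    and so pass from a derivative to its transpose. *)
Lemma enorm_le_dot n (u : 'cV[R]_n) (c : R) :
  0 <= c -> (forall p, dot u p <= c * enorm p) -> enorm u <= c.
Proof.
move=> c0 /(_ u); rewrite -enorm_sqr expr2 => h.
have [->//|u0] := eqVneq (enorm u) 0.
by move: h; rewrite ler_pM2r// lt0r u0 enorm_ge0.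
Qed.

(** The Frobenius norm serves as [B]. Some finite bound is needed before the [sup] in [spnorm] can
    be used as an upper bound. *)
Lemma enorm_mulmx_bounded m n (A : 'M[R]_(m, n)) :
  exists B, forall v, enorm (A *m v) <= B * enorm v.
Proof.
exists (Num.sqrt (\sum_i dot (row i A)^T (row i A)^T)) => v.
have S0 : 0 <= \sum_i dot (row i A)^T (row i A)^T.
  by apply: sumr_ge0 => i _; exact: dot_ge0.
rewrite -ler_sqr ?nnegrE ?mulr_ge0 ?enorm_ge0 ?sqrtr_ge0//.
rewrite exprMn enorm_sqr enorm_sqr sqr_sqrtr// mulr_suml.
apply: ler_sum => i _; rewrite -expr2.
have -> : (A *m v) i 0 = dot (row i A)^T v.
  by rewrite mxE; apply: eq_bigr => j _; rewrite !mxE.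
rewrite -!enorm_sqr -exprMn -[leLHS]real_normK ?num_real//.
rewrite ler_sqr ?nnegrE ?mulr_ge0 ?enorm_ge0//.
by rewrite ler_norml dot_ge dot_le.
Qed.

Lemma enorm_mulmx_le m n (A : 'M[R]_(m, n)) v :
  enorm (A *m v) <= spnorm A * enorm v.
Proof.
have [/eqP|v0] := eqVneq (enorm v) 0.
  by rewrite enorm_eq0 => /eqP ->; rewrite mulmx0 !enorm0 mulr0.
have vp : 0 < enorm v by rewrite lt0r v0 enorm_ge0.
rewrite -ler_pdivrMr//.
have [B HB] := enorm_mulmx_bounded A.
have -> : enorm (A *m v) / enorm v = enorm (A *m ((enorm v)^-1 *: v)).
  by rewrite -scalemxAr enormZ ger0_norm ?invr_ge0 ?enorm_ge0// mulrC.
apply: ub_le_sup.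
  exists `|B| => _ [w /= w1 <-]; apply: le_trans (HB w) _.
  apply: le_trans (ler_wpM2r (enorm_ge0 _) (ler_norm B)) _.
  by rewrite ler_piMr.
exists ((enorm v)^-1 *: v) => //=.
by rewrite enormZ ger0_norm ?invr_ge0 ?enorm_ge0// mulVf.
Qed.

End Euclidean.

(** * Derivatives along lines *)

Section LineDerivatives.
Context {R : realType}.

Lemma is_derive_line (V : normedModType R) (F : V -> R) (p d : V) (t : R) :
  differentiable F (p + t *: d) ->
  is_derive t 1 (fun s : R => F (p + s *: d)) ('d F (p + t *: d) d).
Proof.
move=> dF.
have dl : is_diff t (fun s : R => p + s *: d) (fun s => s *: d).
  have -> : (fun s : R => p + s *: d) = cst p + (fun s : R => s *: d) by [].
  by apply: is_diff_eq; rewrite add0r.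
have dF' : is_diff (p + t *: d) F ('d F (p + t *: d)) by exact: DiffDef.
have dFl := @is_diff_comp _ _ _ _ (fun s : R => p + s *: d) _ F _ t dl dF'.
have dc : differentiable (F \o (fun s : R => p + s *: d)) t by exact: ex_diff.
apply: DeriveDef; first exact: diff_derivable.
by rewrite deriveE//= diff_val /= scale1r.
Qed.

Lemma cV_sum_delta n (u : 'cV[R]_n) : u = \sum_i u i 0 *: delta_mx i 0.
Proof.
by rewrite {1}(matrix_sum_delta u); apply: eq_bigr => i _; rewrite big_ord1.
Qed.

Lemma gradientE n (h : 'cV[R]_n -> R) x u :
  differentiable h x -> 'd h x u = dot u (gradient h x).
Proof.
move=> dh; rewrite {1}(cV_sum_delta u) linear_sum.
by apply: eq_bigr => i _; rewrite linearZ /= mxE deriveE.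
Qed.

Lemma diff_partials n m (h : 'cV[R]_n -> 'cV[R]_m -> R) x y u v :
  differentiable (fun p => h p.1 p.2) (x, y) ->
  [/\ differentiable (h^~ y) x, differentiable (h x) y &
  'd (fun p => h p.1 p.2) (x, y) (u, v)
    = dot u (grad_x h x y) + dot v (grad_y h x y)].
Proof.
set F := fun p : _ * _ => h p.1 p.2 => dF.
have dF' : is_diff (x, y) F ('d F (x, y)) by exact: DiffDef.
have dl : is_diff x (fun x' : 'cV[R]_n => (x', y)) (fun u => (u, 0)) by exact: is_diff_pair.
have dr : is_diff y (fun y' : 'cV[R]_m => (x, y')) (fun u => (0, u)) by exact: is_diff_pair.
have dFl := @is_diff_comp _ _ _ _ (fun x' => (x', y)) _ F _ x dl dF'.
have dFr := @is_diff_comp _ _ _ _ (fun y' => (x, y')) _ F _ y dr dF'.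
have dxh : differentiable (h^~ y) x by case: dFl.
have dyh : differentiable (h x) y by case: dFr.
split=> //.
rewrite -!gradientE//.
rewrite -[h^~ y]/(F \o (fun x' => (x', y))) -[h x]/(F \o (fun y' => (x, y'))).
rewrite (@diff_val _ _ _ _ _ _ _ dFl) (@diff_val _ _ _ _ _ _ _ dFr) /=.
by rewrite -linearD; congr ('d F _ _); congr pair; rewrite ?addr0 ?add0r.
Qed.

Lemma is_derive_partials n m (h : 'cV[R]_n -> 'cV[R]_m -> R) x y u v t :
  differentiable (fun p => h p.1 p.2) (x + t *: u, y + t *: v) ->
  is_derive t 1 (fun s : R => h (x + s *: u) (y + s *: v))
    (dot u (grad_x h (x + t *: u) (y + t *: v))
     + dot v (grad_y h (x + t *: u) (y + t *: v))).
Proof.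
move=> dh; have [_ _ <-] := diff_partials u v dh.
exact: (@is_derive_line _ (fun p => h p.1 p.2) (x, y) (u, v)).
Qed.

Lemma mean_value (phi dphi : R -> R) :
  (forall t : R, 0 <= t <= 1 -> is_derive t 1 phi (dphi t)) ->
  exists2 t, 0 < t < 1 & phi 1 - phi 0 = dphi t.
Proof.
move=> h; have [||t t01 ->] := @MVT _ phi dphi 0 1 ltr01.
- by move=> t; rewrite in_itv /= => /andP[/ltW t0 /ltW t1]; apply: h; rewrite t0.
- apply: derivable_within_continuous => t; rewrite in_itv /= => /h.
  by move=> ?; exact: ex_derive.
- by exists t; [move: t01; rewrite in_itv | rewrite subr0 mulr1].
Qed.

(* The comparison function phi - d t - L t^2/2 is nonincreasing; the crude
   mean value bound would lose the factor 1/2. *)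
Lemma taylor1_le (phi dphi : R -> R) (L : R) :
  (forall t : R, 0 <= t <= 1 -> is_derive t 1 phi (dphi t)) ->
  (forall t : R, 0 <= t <= 1 -> dphi t - dphi 0 <= L * t) ->
  phi 1 <= phi 0 + dphi 0 + L / 2.
Proof.
move=> h hL.
pose psi t := phi t - dphi 0 * t - L / 2 * t ^+ 2.
have dpsi (t : R) : 0 <= t <= 1 -> is_derive t 1 psi (dphi t - dphi 0 - L * t).
  move=> /h ht; rewrite /psi.
  have -> : (fun t0 : R => phi t0 - dphi 0 * t0 - L / 2 * t0 ^+ 2)
    = (phi - dphi 0 *: id - (L / 2) *: (fun t => t ^+ 2)) by [].
  apply: is_derive_eq; rewrite -![_ *: _]/(_ * _) !mulr1; lra.
have [t /andP[/ltW t0 /ltW t1]] := mean_value dpsi.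
have := hL t; rewrite t0 t1 /psi => /(_ isT) ? e; lra.
Qed.

(** Only positive [t] are tested: a feasible direction stays in [X] on one side only, and convexity
    bounds are available for [t] in the unit interval. *)
Lemma is_derive_bound (phi : R -> R) (d c : R) : is_derive (0 : R) 1 phi d ->
  (forall t : R, 0 < t <= 1 -> phi t - phi 0 <= c * t) -> d <= c.
Proof.
move=> h hc.
have hd : (t^-1 *: (phi (t + 0) - phi 0)) @[t --> 0^'] --> d.
  have := @ex_derive _ _ _ _ _ _ _ h; rewrite /derivable => /cvg_ex [l hl].
  have := @derive_val _ _ _ _ _ _ _ h; rewrite /derive => <-.
  rewrite (cvg_lim _ hl)//; apply: cvg_trans hl.
  by apply: near_eq_cvg; near=> t; rewrite /= /GRing.scale/= mulr1.
have hr : (t^-1 *: (phi (t + 0) - phi 0)) @[t --> 0^'+] --> d.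
  apply: cvg_trans hd; apply: cvg_app => A; rewrite /at_right /dnbhs /within /=.
  by apply: (@filterS _ (nbhs (0 : R))) => t h1 t0; apply: h1; rewrite gt_eqF.
apply: (cvgr_to_le hr); near=> t.
have t0 : 0 < t by [].
rewrite addr0 -[_ *: _]/(_ * _) mulrC ler_pdivrMr//; apply: hc.
rewrite t0; near: t; exact: nbhs_right_le.
Unshelve. all: by end_near.
Qed.

End LineDerivatives.

(** * Strongly convex smooth functions *)

Lemma trmx_continuous (T : topologicalType) m n :
  continuous (@trmx T m n : 'M[T]_(m, n) -> 'M[T]_(n, m)).
Proof.
move=> v B [P hP hB]; exists (fun i j => P j i) => [i j|w hw].
  by have := hP j i; rewrite mxE.
by apply: hB => i j; rewrite mxE; exact: hw.
Qed.

Section StronglyConvexSmooth.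
Context {R : realType} {m : nat} (h : 'cV[R]_m -> R) (mu L : R).
Context (dh : forall y, differentiable h y).
Context (mu_gt0 : 0 < mu).
Context (h_convex : strongly_convex mu h).
Context (h_smooth : forall u v,
  enorm (gradient h u - gradient h v) <= L * enorm (u - v)).
Let G := gradient h.

Lemma is_derive_segment (u d : 'cV[R]_m) (t : R) :
  is_derive t 1 (fun s : R => h (u + s *: d)) (dot d (G (u + t *: d))).
Proof. by rewrite -gradientE//; exact: is_derive_line. Qed.

Lemma strongly_convex_lower u v :
  h u + dot (v - u) (G u) + mu / 2 * enorm (v - u) ^+ 2 <= h v.
Proof.
set N := enorm (v - u) ^+ 2.
(* Subtracting the quadratic turns the strong convexity bound, with its factor t(1 - t), into one
   exactly linear in [t], as [is_derive_bound] requires. *)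
pose psi (t : R) := h (u + t *: (v - u)) - mu / 2 * N * t ^+ 2.
have dpsi : is_derive (0 : R) 1 psi (dot (v - u) (G u)).
  have ht := is_derive_segment u (v - u) 0.
  rewrite /psi.
  have -> : (fun t : R => h (u + t *: (v - u)) - mu / 2 * N * t ^+ 2)
    = (fun t : R => h (u + t *: (v - u))) - (mu / 2 * N) *: (fun t => t ^+ 2) by [].
  by apply: is_derive_eq; rewrite scale0r addr0 scale0r addr0 scaler0 subr0.
have /(_ _) := @is_derive_bound R psi _ (h v - h u - mu / 2 * N) dpsi.
suff hh : forall t : R, 0 < t <= 1 -> psi t - psi 0 <= (h v - h u - mu / 2 * N) * t.
  by move=> /(_ hh); lra.
move=> t /andP[t0 t1]; rewrite /psi scale0r addr0 expr0n /= mulr0 subr0.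
have := @h_convex u v t; rewrite (ltW t0) t1 => /(_ isT).
have -> : (1 - t) *: u + t *: v = u + t *: (v - u).
  by rewrite scalerBl scale1r scalerBr addrAC addrA.
rewrite (enormBC u v) -/N => hc.
suff -> : (h v - h u - mu / 2 * N) * t
  = (1 - t) * h u + t * h v - mu / 2 * t * (1 - t) * N - mu / 2 * N * t ^+ 2 - h u.
  by lra.
by field.
Qed.

Lemma smooth_upper u v :
  h v <= h u + dot (v - u) (G u) + L / 2 * enorm (v - u) ^+ 2.
Proof.
have := @taylor1_le R (fun t : R => h (u + t *: (v - u)))
  (fun t => dot (v - u) (G (u + t *: (v - u)))) (L * enorm (v - u) ^+ 2).
rewrite !scale0r !addr0 !scale1r [u + (v - u)]addrC subrK => hh.
apply: (le_trans (hh _ _)).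
- by move=> t _; exact: is_derive_segment.
- move=> t /andP[t0 t1]; rewrite -dotBr; apply: le_trans (dot_le _ _) _.
  have := h_smooth (u + t *: (v - u)) u.
  rewrite [u + _]addrC addrK enormZ ger0_norm// => /(ler_wpM2l (enorm_ge0 (v - u))).
  by move/le_trans; apply; rewrite le_eqVlt; apply/orP; left; apply/eqP; ring.
- by rewrite le_eqVlt; apply/orP; left; apply/eqP; field.
Qed.

Lemma strong_convexity_le_smoothness : (0 < m)%N -> mu <= L.
Proof.
move=> m0; pose e : 'cV[R]_m := const_mx 1.
have e0 : 0 < enorm (e - 0) ^+ 2.
  rewrite subr0 exprn_gt0// lt0r enorm_ge0 andbT enorm_eq0.
  by apply/eqP => /matrixP/(_ (Ordinal m0) ord0); rewrite !mxE; apply/eqP/oner_neq0.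
have := strongly_convex_lower 0 e; have := smooth_upper 0 e => up lo.
by rewrite -(ler_pM2r e0); lra.
Qed.

Lemma strongly_monotone u v : mu * enorm (v - u) ^+ 2 <= dot (v - u) (G v - G u).
Proof.
have := strongly_convex_lower u v; have := strongly_convex_lower v u.
rewrite (enormBC u v) -(opprB v u) dotNl dotBr; lra.
Qed.

(* Cocoercivity of the gradient of h - mu/2 |.|^2, obtained by testing
   convexity and smoothness at the gradient steps v - t D and u + t D. *)
Lemma gradient_cocoercive_shift u v (D := G v - G u - mu *: (v - u)) :
  mu <= L -> enorm D ^+ 2 <= (L - mu) * dot (v - u) D.
Proof.
move=> muL.
have step u' v' d D' (t : R) : d = v' - u' -> D' = G v' - G u' - mu *: d ->
    h u' + dot d (G u') + mu / 2 * enorm d ^+ 2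
      + (t - (L - mu) / 2 * t ^+ 2) * enorm D' ^+ 2 <= h v'.
  move=> ed eD'; have lo := strongly_convex_lower u' (v' - t *: D').
  have up := smooth_upper v' (v' - t *: D').
  have e1 : v' - t *: D' - u' = d - t *: D' by rewrite ed addrAC.
  have e2 : v' - t *: D' - v' = - (t *: D') by rewrite addrAC subrr add0r.
  have eD : t * dot D' D' = t * (dot D' (G v') - dot D' (G u') - mu * dot D' d).
    by rewrite {2}eD' !(dotBr, dotZr).
  move: lo up; rewrite e1 e2 !enorm_sqr !(dotNl, dotNr, dotBl, dotBr, dotZl, dotZr).
  by rewrite (dotC d D'); lra.
(* Sum of [step] for (u, v, D) and for (v, u, -D): the values of [h] cancel. The best [t] is 1/(L -
   mu), used below. *)
have key t : (2 * t - (L - mu) * t ^+ 2) * enorm D ^+ 2 <= dot (v - u) D.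
  have eD : - D = G u - G v - mu *: - (v - u).
    by rewrite /D scalerN opprK opprB addrC opprB.
  have := step u v _ D t erefl erefl; have := step v u _ _ t (opprB v u) eD.
  rewrite !enormN dotNl; have : dot (v - u) D
    = dot (v - u) (G v) - dot (v - u) (G u) - mu * enorm (v - u) ^+ 2.
    by rewrite enorm_sqr -dotZr -!dotBr.
  lra.
have [l0|] := ltrP 0 (L - mu).
  have := key (L - mu)^-1.
  have -> : 2 * (L - mu)^-1 - (L - mu) * (L - mu)^-1 ^+ 2 = (L - mu)^-1.
    by field; rewrite gt_eqF.
  by rewrite mulrC ler_pdivrMr// mulrC.
(* Degenerate case L = mu: [key] loses its quadratic term and bounds 2t |D|^2 for every [t], which
   forces D = 0. *)
move=> l0; have {l0} e : L - mu = 0 by lra.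
rewrite e mul0r; case: (ltrP 0 (enorm D ^+ 2)) => // N0.
have k1 := key 1; have := key (dot (v - u) D / enorm D ^+ 2).
rewrite e in k1 *; rewrite !mul0r !subr0 in k1 *.
by rewrite mulrA divfK ?gt_eqF//; lra.
Qed.

(** For increments d, g of the point and the gradient, cocoercivity reads |g|^2 + mu L |d|^2 <= (L +
    mu) <d, g>. Since alpha (L + mu) = 2, multiplying by alpha^2 reproduces the cross term of |d -
    alpha g|^2 exactly and leaves the factor 1 - alpha^2 mu L = beta^2. *)
Lemma gradient_step_contract u v : mu <= L ->
  enorm ((v - ibcg_alpha mu L *: G v) - (u - ibcg_alpha mu L *: G u))
    <= ibcg_beta mu L * enorm (v - u).
Proof.
move=> muL; have := gradient_cocoercive_shift u v muL; rewrite /=.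
set d := v - u; set g := G v - G u; set a := ibcg_alpha mu L => co.
have -> : v - a *: G v - (u - a *: G u) = d - a *: g.
  by rewrite /d /g scalerBr !opprD !opprK addrACA.
clearbody g d.
have sp : L + mu != 0 by rewrite lt0r_neq0 ?addr_gt0 ?(lt_le_trans mu_gt0 muL).
have b0 : 0 <= ibcg_beta mu L.
  by rewrite divr_ge0 ?subr_ge0 ?addr_ge0 ?(ltW mu_gt0) ?(le_trans (ltW mu_gt0) muL).
have bd0 := mulr_ge0 b0 (enorm_ge0 d).
rewrite -ler_sqr ?nnegrE ?enorm_ge0// exprMn.
move: co; rewrite !enorm_sqr !(dotBl, dotBr, dotZl, dotZr) (dotC g d).
set x := dot d d; set y := dot d g; set z := dot g g => co.
have {}co : z + mu * L * x - (L + mu) * y <= 0 by nra.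
have -> : ibcg_beta mu L ^+ 2 = 1 - a ^+ 2 * (mu * L).
  by rewrite /ibcg_beta /a /ibcg_alpha; field; rewrite addrC.
have e : a * (L + mu) = 2 by rewrite /a /ibcg_alpha (addrC mu) divfK.
have : a ^+ 2 * (z + mu * L * x - (L + mu) * y) <= 0 by rewrite mulr_ge0_le0 ?sqr_ge0.
have -> : a ^+ 2 * (z + mu * L * x - (L + mu) * y)
   = a ^+ 2 * z + a ^+ 2 * (mu * L) * x - a * (a * (L + mu)) * y by ring.
rewrite e; lra.
Qed.

Lemma exists_minimizer : exists y, forall y', h y <= h y'.
Proof.
(* Beyond this radius the quadratic in the lower bound at 0 dominates its linear term, so [h]
   exceeds [h 0]. The minimum is then taken over the cube [A], which contains the ball of radius
   [r]. *)
pose r := 2 * enorm (G 0) / mu.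
have r0 : 0 <= r by rewrite divr_ge0 ?mulr_ge0 ?enorm_ge0 ?ltW.
pose A := [set v : 'rV[R]_m | forall i, `[- r, r]%classic (v ord0 i)].
have cA : compact A by apply: (@rV_compact _ _ (fun=> _)) => i; exact: segment_compact.
have A0 : A 0 by move=> i; rewrite /= in_itv /= mxE; apply/andP; split; lra.
have ct : continuous (fun v : 'rV[R]_m => h v^T).
  move=> v; apply: continuous_comp; last exact: differentiable_continuous.
  exact: trmx_continuous.
have [v vA hv] := EVT_min_rV (ex_intro _ _ A0) cA (continuous_subspaceT ct).
exists v^T => y'; have [yr|yr] := lerP (enorm y') r.
  have := hv y'^T; rewrite trmxK; apply; rewrite inE => i.
  have hi : `|y' i 0| <= r.
    apply: le_trans yr; rewrite -ler_sqr ?nnegrE ?enorm_ge0// enorm_sqr real_normK ?num_real//.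
    rewrite /dot (bigD1 i)//= -expr2 lerDl; apply: sumr_ge0 => j _; rewrite -expr2; exact: sqr_ge0.
  by rewrite /= in_itv /= mxE; move: hi; rewrite ler_norml.
have := hv 0; rewrite inE trmx0 => /(_ A0) h0.
apply: le_trans h0 _; have := strongly_convex_lower 0 y'; rewrite subr0.
have := dot_ge y' (G 0); move: yr; rewrite /r ltr_pdivrMr// => yr c1 c2.
have : 0 <= enorm y' * (mu / 2 * enorm y' - enorm (G 0)).
  by rewrite mulr_ge0 ?enorm_ge0//; lra.
by move: c2; rewrite expr2; lra.
Qed.

(** Along the direction [- G y] the function [- h] has initial slope |G y|^2, which minimality
    bounds by 0. *)
Lemma gradient_minimizer y : (forall y', h y <= h y') -> G y = 0.
Proof.
move=> hy; apply/eqP; rewrite -enorm_eq0 -sqrf_eq0 enorm_sqr.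
have := is_derive_segment y (- G y) 0; rewrite scale0r addr0 => hd.
have hd' : is_derive (0 : R) 1 (- (fun s : R => h (y + s *: - G y))) (- dot (- G y) (G y)).
  exact: is_deriveN.
rewrite dotNl opprK in hd'.
rewrite eq_le dot_ge0 andbT; apply: (is_derive_bound hd') => t _.
rewrite mul0r -[X in X - _]/(- h (y + t *: - G y)) -[X in _ - X]/(- h (y + 0 *: - G y)).
by rewrite scale0r addr0 opprK addrC subr_le0.
Qed.

End StronglyConvexSmooth.

(** * First-order expansions of functions of two blocks *)

Section BilevelGeometry.
Context {R : realType}.

Lemma convex_set_segment n (X : set 'cV[R]_n) x x' (t : R) :
  convex_set X -> X x -> X x' -> 0 <= t <= 1 -> X (x + t *: (x' - x)).
Proof.
move=> cX Xx Xx' /andP[t0 t1].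
have := cX x' x (Itv01 t0 t1); rewrite !inE => /(_ Xx' Xx).
have -> : x + t *: (x' - x) = t *: x' + (1 - t) *: x => //.
by rewrite scalerBl scale1r addrCA -scalerBr.
Qed.

(** The matrix is the transposed Jacobian, with the index order of [hess_yx] and [hess_yy]; hence a
    Hessian applied to [p] is the gradient of a real function. *)
Lemma gradient_dot k m (Phi : 'cV[R]_k -> 'cV[R]_m) (p : 'cV[R]_m) x :
  differentiable Phi x ->
  differentiable (fun z => dot p (Phi z)) x /\
  gradient (fun z => dot p (Phi z)) x
    = (\matrix_(i < k, j < m) 'D_(delta_mx i 0) (fun z => Phi z j 0) x) *m p.
Proof.
move=> dPhi.
have dj j : differentiable (fun z => Phi z j 0) x.
  apply: (@differentiable_comp _ _ _ _ Phi (fun v : 'cV[R]_m => v j 0)) => //.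
  exact: differentiable_coord.
have E : (fun z => dot p (Phi z)) = \sum_(j < m) (p j 0 *: (fun z => Phi z j 0)).
  by apply/funext => z; rewrite fct_sumE.
split.
  by rewrite E; apply: differentiable_sum => j; exact: differentiableZ.
apply/matrixP => i j; rewrite ord1 !mxE E derive_sum; last first.
  by move=> l; apply: derivableZ; exact: diff_derivable.
apply: eq_bigr => l _; rewrite deriveZ; last exact: diff_derivable.
by rewrite mxE mulrC.
Qed.

Lemma dot_grad_y_partials n m (g : 'cV[R]_n -> 'cV[R]_m -> R) p x y :
  differentiable (fun q => grad_y g q.1 q.2) (x, y) ->
  [/\ differentiable (fun q => dot p (grad_y g q.1 q.2)) (x, y),
   grad_x (fun x y => dot p (grad_y g x y)) x y = hess_yx g x y *m p &
   grad_y (fun x y => dot p (grad_y g x y)) x y = hess_yy g x y *m p].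
Proof.
set F := fun q : _ * _ => grad_y g q.1 q.2 => dF; split.
- have dp v : differentiable (fun v : 'cV[R]_m => dot p v) v.
    have di : differentiable (@id 'cV[R]_m) v by exact: ex_diff.
    by have [] := gradient_dot p di.
  exact: (@differentiable_comp _ _ _ _ F (fun v : 'cV[R]_m => dot p v)).
- have dl : is_diff x (fun x' : 'cV[R]_n => (x', y)) (fun u => (u, 0)).
    exact: is_diff_pair.
  have dx : differentiable (F \o (fun x' => (x', y))) x.
    by apply: differentiable_comp => //; case: dl.
  by have [_] := gradient_dot p dx.
- have dr : is_diff y (fun y' : 'cV[R]_m => (x, y')) (fun u => (0, u)).
    exact: is_diff_pair.
  have dy : differentiable (F \o (fun y' => (x, y'))) y.
    by apply: differentiable_comp => //; case: dr.
  by have [_] := gradient_dot p dy.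
Qed.

Lemma mean_value_segment n m (X : set 'cV[R]_n) (h : 'cV[R]_n -> 'cV[R]_m -> R)
    x x' y y' :
  (forall x y, X x -> differentiable (fun q => h q.1 q.2) (x, y)) ->
  convex_set X -> X x -> X x' ->
  exists x1 y1, [/\ X x1, enorm (x1 - x) <= enorm (x' - x),
    enorm (y1 - y) <= enorm (y' - y) &
    h x' y' - h x y = dot (x' - x) (grad_x h x1 y1) + dot (y' - y) (grad_y h x1 y1)].
Proof.
move=> dh cX Xx Xx'.
have [t /andP[/ltW t0 /ltW t1]] := @mean_value R
  (fun t : R => h (x + t *: (x' - x)) (y + t *: (y' - y))) _
  (fun t ht => is_derive_partials (dh _ _ (convex_set_segment cX Xx Xx' ht))).
rewrite !scale1r !scale0r !addr0 [x + _]addrC [y + _]addrC !subrK => e.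
exists (x + t *: (x' - x)), (y + t *: (y' - y)); split=> //.
- by apply: convex_set_segment; rewrite ?t0.
- by rewrite addrAC subrr add0r enormZ ger0_norm// ler_piMl ?enorm_ge0.
- by rewrite addrAC subrr add0r enormZ ger0_norm// ler_piMl ?enorm_ge0.
Qed.

(** The mean value point is feasible and no farther from (x, y) than (x', y'): one factor of the
    displacement comes from the variation of the gradients, the other from Cauchy-Schwarz. A sharp
    factor is immaterial here, because the remainder only enters the final constant. *)
Lemma first_order_remainder n m (X : set 'cV[R]_n)
    (h : 'cV[R]_n -> 'cV[R]_m -> R) x x' y y' (A B : R) :
  (forall x y, X x -> differentiable (fun q => h q.1 q.2) (x, y)) ->
  convex_set X -> X x -> X x' -> 0 <= A -> 0 <= B ->
  (forall x1 y1, X x1 ->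
    enorm (grad_x h x1 y1 - grad_x h x y) <= A * (enorm (x1 - x) + enorm (y1 - y))) ->
  (forall x1 y1, X x1 ->
    enorm (grad_y h x1 y1 - grad_y h x y) <= B * (enorm (x1 - x) + enorm (y1 - y))) ->
  h x' y' <= h x y + dot (x' - x) (grad_x h x y) + dot (y' - y) (grad_y h x y)
    + (A + B) * (enorm (x' - x) + enorm (y' - y)) ^+ 2.
Proof.
move=> dh cX Xx Xx' A0 B0 hA hB.
have [x1 [y1 [Xx1 hx hy e]]] := mean_value_segment y y' dh cX Xx Xx'.
set u := enorm (x' - x) in hx *; set v := enorm (y' - y) in hy *.
have u0 : 0 <= u := enorm_ge0 _; have v0 : 0 <= v := enorm_ge0 _.
have uv0 : 0 <= u + v by exact: addr_ge0.
have bx : dot (x' - x) (grad_x h x1 y1 - grad_x h x y) <= A * (u + v) ^+ 2.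
  apply: le_trans (dot_le _ _) _; rewrite -/u.
  have h1 : enorm (grad_x h x1 y1 - grad_x h x y) <= A * (u + v).
    by apply: le_trans (hA _ _ Xx1) _; rewrite ler_wpM2l// lerD.
  apply: le_trans (ler_wpM2l u0 h1) _; rewrite expr2 mulrCA ler_wpM2l//.
  by rewrite ler_wpM2r// lerDl.
have by_ : dot (y' - y) (grad_y h x1 y1 - grad_y h x y) <= B * (u + v) ^+ 2.
  apply: le_trans (dot_le _ _) _; rewrite -/v.
  have h1 : enorm (grad_y h x1 y1 - grad_y h x y) <= B * (u + v).
    by apply: le_trans (hB _ _ Xx1) _; rewrite ler_wpM2l// lerD.
  apply: le_trans (ler_wpM2l v0 h1) _; rewrite expr2 mulrCA ler_wpM2l//.
  by rewrite ler_wpM2r// lerDr.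
move: bx by_; rewrite !dotBr mulrDl; lra.
Qed.

End BilevelGeometry.

(** * The lower-level solution map *)

Section LowerLevel.
Context {R : realType} {n m : nat} (X : set 'cV[R]_n)
  (g : 'cV[R]_n -> 'cV[R]_m -> R) (mu L Cyx Lyx Lyy Lam : R).
Context (m_gt0 : (0 < m)%N) (X_conv : convex_set X)
  (g_hyp : g_assumption X g mu L Cyx Lyx Lyy).
Context (CyxLam : `|Cyx| <= Lam) (LyxLam : `|Lyx| <= Lam) (LyyLam : `|Lyy| <= Lam).
Let mu0 := g_mu_gt0 g_hyp.
Let y_ x := ystar g x.

Let Lam0 : 0 <= Lam. Proof. exact: le_trans CyxLam. Qed.

Lemma g_differentiable x y : X x -> differentiable (g x) y.
Proof. by case/(g_C2 g_hyp) => -[_ /(_ y)[]]. Qed.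

Lemma mu_le_Lg x : X x -> mu <= L.
Proof.
move=> Xx; apply: (@strong_convexity_le_smoothness R m (g x)) => //.
- by move=> y; exact: g_differentiable.
- exact: (g_strongly_convex g_hyp).
- by move=> u v; exact: (g_grad_y_lip_y g_hyp).
Qed.

Lemma grad_y_step_contract x u v : X x ->
  enorm ((v - ibcg_alpha mu L *: grad_y g x v) - (u - ibcg_alpha mu L *: grad_y g x u))
    <= ibcg_beta mu L * enorm (v - u).
Proof.
move=> Xx; apply: (@gradient_step_contract R m (g x)) => //.
- by move=> y; exact: g_differentiable.
- exact: (g_strongly_convex g_hyp).
- by move=> u' v'; exact: (g_grad_y_lip_y g_hyp).
- exact: mu_le_Lg Xx.
Qed.

Lemma grad_y_ystar x : X x -> grad_y g x (y_ x) = 0.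
Proof.
move=> Xx; have dg y : differentiable (g x) y by exact: g_differentiable.
apply: gradient_minimizer => //.
apply: (@getPex _ [set y | forall y', g x y <= g x y']).
exact: (exists_minimizer dg mu0 (g_strongly_convex g_hyp Xx)).
Qed.

Lemma ystar_lipschitz x x' : X x -> X x' ->
  enorm (y_ x' - y_ x) <= Lam / mu * enorm (x' - x).
Proof.
move=> Xx Xx'; set d := y_ x' - y_ x.
have := @strongly_monotone R m (g x') mu (fun y => g_differentiable y Xx')
  (g_strongly_convex g_hyp Xx') (y_ x) (y_ x').
(* The vanishing gradient at (x', y* x') is replaced by the one at (x, y* x), also zero, so that the
   difference varies only [x] at the fixed point [y_ x]. *)
rewrite -!/(grad_y g _ _) (grad_y_ystar Xx') -(grad_y_ystar Xx) -/d => h1.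
have h2 := le_trans h1 (dot_le _ _).
have h3 := g_grad_y_lip_x g_hyp (y_ x) Xx Xx'.
have h4 : enorm (grad_y g x (y_ x) - grad_y g x' (y_ x)) <= Lam * enorm (x' - x).
  apply: le_trans h3 _; rewrite enormBC ler_wpM2r ?enorm_ge0//.
  exact: le_trans (ler_norm _) CyxLam.
have [->|d0] := eqVneq (enorm d) 0.
  by rewrite mulr_ge0 ?enorm_ge0// divr_ge0// ltW.
have dp : 0 < enorm d by rewrite lt0r d0 enorm_ge0.
rewrite mulrAC ler_pdivlMr// mulrC -(ler_pM2r dp) -mulrA -expr2.
apply: le_trans h2 _; rewrite mulrC ler_wpM2r// enorm_ge0//.
Qed.

Lemma dot_grad_y_differentiable p x y : X x ->
  differentiable (fun q => dot p (grad_y g q.1 q.2)) (x, y).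
Proof.
move=> Xx; have [U [XU [_ /(_ (x, y))]]] := g_grad_y_C1 g_hyp.
case; first exact: XU.
by move=> dF _; have [] := dot_grad_y_partials p dF.
Qed.

Lemma dot_grad_y_grad p x y : X x ->
  grad_x (fun x y => dot p (grad_y g x y)) x y = hess_yx g x y *m p /\
  grad_y (fun x y => dot p (grad_y g x y)) x y = hess_yy g x y *m p.
Proof.
move=> Xx; have [U [XU [_ /(_ (x, y))]]] := g_grad_y_C1 g_hyp.
case; first exact: XU.
by move=> dF _; have [] := dot_grad_y_partials p dF.
Qed.

(* The cross Hessian is only controlled along feasible directions, since X may
   have empty interior. *)
Lemma hess_yx_le x x' y w : X x -> X x' ->
  dot (x' - x) (hess_yx g x y *m w) <= Lam * enorm w * enorm (x' - x).
Proof.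
move=> Xx Xx'; have [ex _] := dot_grad_y_grad w y Xx.
have := @is_derive_partials R n m (fun x y => dot w (grad_y g x y)) x y (x' - x) 0 0.
rewrite !scaler0 !scale0r !addr0 => /(_ (dot_grad_y_differentiable w y Xx)).
rewrite dot0l addr0 ex => hd.
apply: (is_derive_bound hd) => t /andP[t0 t1].
rewrite !scaler0 scale0r !addr0 -dotBr.
apply: le_trans (dot_le _ _) _.
have Xt : X (x + t *: (x' - x)) by apply: convex_set_segment; rewrite // ltW.
have := g_grad_y_lip_x g_hyp y Xt Xx.
have -> : x + t *: (x' - x) - x = t *: (x' - x) by rewrite addrAC subrr add0r.
rewrite enormZ gtr0_norm// => h1.
have h2 : Cyx * (t * enorm (x' - x)) <= Lam * (t * enorm (x' - x)).
  apply: ler_wpM2r; first by rewrite mulr_ge0 ?enorm_ge0 ?ltW.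
  exact: le_trans (ler_norm _) CyxLam.
have := ler_wpM2l (enorm_ge0 w) (le_trans h1 h2).
by move=> /le_trans; apply; rewrite le_eqVlt; apply/orP; left; apply/eqP; ring.
Qed.

(** The gradient step between [y] and [y + t *: p], tested against [w], has slope
    [dot (w - alpha H w) p] at t = 0. Its contraction bounds that slope by beta |w| |p|, and
    [enorm_le_dot] removes [p]. *)
Lemma hess_yy_contract x y w : X x ->
  enorm (w - ibcg_alpha mu L *: (hess_yy g x y *m w)) <= ibcg_beta mu L * enorm w.
Proof.
move=> Xx; have [_ ey] := dot_grad_y_grad w y Xx.
set a := ibcg_alpha mu L.
have b0 : 0 <= ibcg_beta mu L.
  have muL := mu_le_Lg Xx.
  by rewrite divr_ge0 ?subr_ge0// addr_ge0 ?(le_trans (ltW mu0))// ltW.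
apply: enorm_le_dot => [|p]; first by rewrite mulr_ge0 ?enorm_ge0.
have := @is_derive_partials R n m (fun x y => dot w (grad_y g x y)) x y 0 p 0.
rewrite !scaler0 !scale0r !addr0 => /(_ (dot_grad_y_differentiable w y Xx)).
rewrite dot0l add0r ey => hd.
pose psi := (dot w p *: id : R -> R) - a *: (fun s : R => dot w (grad_y g (x + s *: 0) (y + s *: p))).
have hpsi : is_derive (0 : R) 1 psi (dot (w - a *: (hess_yy g x y *m w)) p).
  apply: is_derive_eq; rewrite dotBl dotZl (dotC (_ *m _)).
  by congr (_ - _); exact: mulr1.
apply: (is_derive_bound hpsi) => t /andP[t0 t1].
have -> : psi t - psi 0 = dot w ((y + t *: p - a *: grad_y g x (y + t *: p))
    - (y - a *: grad_y g x y)).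
  rewrite /psi -[X in X - _ = _]/(dot w p * t - a * dot w (grad_y g (x + t *: 0) (y + t *: p))).
  rewrite -[X in _ - X = _]/(dot w p * 0 - a * dot w (grad_y g (x + 0 *: 0) (y + 0 *: p))).
  rewrite !scaler0 !addr0 scale0r addr0 !(dotNr, dotDr, dotZr); ring.
apply: le_trans (dot_le _ _) _.
have := grad_y_step_contract y (y + t *: p) Xx.
have -> : y + t *: p - y = t *: p by rewrite addrAC subrr add0r.
rewrite -/a enormZ gtr0_norm// => /(ler_wpM2l (enorm_ge0 w)).
by move=> /le_trans; apply; rewrite le_eqVlt; apply/orP; left; apply/eqP; ring.
Qed.

(** Triangle inequality on w = (w - alpha H w) + alpha H w; since alpha mu = 1 - beta, the constant
    [mu] comes out without loss. *)
Lemma hess_yy_lower x y w : X x -> mu * enorm w <= enorm (hess_yy g x y *m w).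
Proof.
move=> Xx; have := hess_yy_contract y w Xx.
have muL := mu_le_Lg Xx.
have L0 : 0 < mu + L by rewrite addr_gt0 ?(lt_le_trans mu0).
have a0 : 0 < ibcg_alpha mu L by rewrite divr_gt0.
set H := hess_yy g x y => h1.
rewrite -(ler_pM2l a0) mulrA.
have -> : ibcg_alpha mu L * mu = 1 - ibcg_beta mu L.
  by rewrite /ibcg_alpha /ibcg_beta; field; rewrite addrC ?gt_eqF// addrC gt_eqF.
have := enormD (w - ibcg_alpha mu L *: (H *m w)) (ibcg_alpha mu L *: (H *m w)).
rewrite subrK enormZ gtr0_norm// => h2; lra.
Qed.

(** The lower bound makes the Hessian injective on columns; [kermx] concerns rows, hence the
    transposes. *)
Lemma hess_yy_unit x y : X x -> hess_yy g x y \in unitmx.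
Proof.
move=> Xx; rewrite -unitmx_tr -row_free_unit -kermx_eq0.
apply/eqP/row_matrixP => i; rewrite row0.
set v := row i _; have hv : v *m (hess_yy g x y)^T = 0.
  by rewrite /v -row_mul mulmx_ker row0.
have := hess_yy_lower y v^T Xx.
rewrite -[hess_yy _ _ _]trmxK -trmx_mul hv trmx0 enorm0.
rewrite pmulr_rle0// => h0.
apply: trmx_inj; apply/eqP; rewrite trmx0 -enorm_eq0.
by rewrite eq_le h0 enorm_ge0.
Qed.

Lemma hess_yx_lipschitz x x' y y' w : X x -> X x' ->
  enorm (hess_yx g x y *m w - hess_yx g x' y' *m w)
    <= Lam * enorm w * (enorm (x - x') + enorm (y - y')).
Proof.
move=> Xx Xx'; rewrite -mulmxBl; apply: le_trans (enorm_mulmx_le _ _) _.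
rewrite mulrAC ler_wpM2r ?enorm_ge0//.
apply: le_trans (g_hess_yx_lip g_hyp _ _ Xx Xx') _.
by rewrite ler_wpM2r ?addr_ge0 ?enorm_ge0// (le_trans (ler_norm _) LyxLam).
Qed.

Lemma hess_yy_lipschitz x x' y y' w : X x -> X x' ->
  enorm (hess_yy g x y *m w - hess_yy g x' y' *m w)
    <= Lam * enorm w * (enorm (x - x') + enorm (y - y')).
Proof.
move=> Xx Xx'; rewrite -mulmxBl; apply: le_trans (enorm_mulmx_le _ _) _.
rewrite mulrAC ler_wpM2r ?enorm_ge0//.
apply: le_trans (g_hess_yy_lip g_hyp _ _ Xx Xx') _.
by rewrite ler_wpM2r ?addr_ge0 ?enorm_ge0// (le_trans (ler_norm _) LyyLam).
Qed.

(* Replaces the implicit function theorem: both gradients vanish, so the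
   linearisation of grad_y g maps the displacement (x' - x, y* x' - y* x) to a
   second order remainder. *)
Lemma ystar_linearised x x' w : X x -> X x' ->
  - dot (x' - x) (hess_yx g x (y_ x) *m w)
    - dot (y_ x' - y_ x) (hess_yy g x (y_ x) *m w)
  <= 2 * Lam * enorm w * (enorm (x' - x) + enorm (y_ x' - y_ x)) ^+ 2.
Proof.
move=> Xx Xx'; have [ex ey] := dot_grad_y_grad w (y_ x) Xx.
have A0 : 0 <= Lam * enorm w by rewrite mulr_ge0 ?enorm_ge0.
have hyx x1 y1 : X x1 -> enorm (grad_x (fun x y => dot w (grad_y g x y)) x1 y1
    - hess_yx g x (y_ x) *m w) <= Lam * enorm w * (enorm (x1 - x) + enorm (y1 - y_ x)).
  by move=> Xx1; have [-> _] := dot_grad_y_grad w y1 Xx1; exact: hess_yx_lipschitz.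
have hyy x1 y1 : X x1 -> enorm (grad_y (fun x y => dot w (grad_y g x y)) x1 y1
    - hess_yy g x (y_ x) *m w) <= Lam * enorm w * (enorm (x1 - x) + enorm (y1 - y_ x)).
  by move=> Xx1; have [_ ->] := dot_grad_y_grad w y1 Xx1; exact: hess_yy_lipschitz.
rewrite -ex in hyx; rewrite -ey in hyy.
have := first_order_remainder (y_ x') (@dot_grad_y_differentiable w)
  X_conv Xx Xx' A0 A0 hyx hyy.
by rewrite ex ey !grad_y_ystar// (dotC _ 0) dot0l; lra.
Qed.

End LowerLevel.

(** * The adjoint solution and the bilevel objective *)

Section MatrixIdentities.
Context {R : realType}.

Lemma mulmx_sub_residual m (A B : 'M[R]_m) (u v a b : 'cV[R]_m) :
  B *m u = b -> A *m v = a ->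
  A *m (v - u) = (a - b) - (A *m u - B *m u).
Proof. by move=> <- <-; rewrite mulmxBr opprB addrA subrK. Qed.

(** With eta = c alpha the update of w is a convex combination of standing still and of the
    contracting step with alpha, plus a residual in which the matrices act only on the exact
    solution [v]. *)
Lemma relaxed_step_split m (c al : R) (A B : 'M[R]_m) (w v a b : 'cV[R]_m) :
  B *m v = b ->
  (1%:M - (c * al) *: A) *m w + (c * al) *: a - v
  = (1 - c) *: (w - v) + c *: ((w - v) - al *: (A *m (w - v)))
    + (c * al) *: ((a - b) - (A *m v - B *m v)).
Proof.
move=> <-; rewrite mulmxBl mul1mx -scalemxAl mulmxBr.
move: (A *m w) (A *m v) (B *m v) => r s t.
by apply/matrixP => i j; rewrite !mxE; ring.
Qed.

(** The difference of the two matrices falls on [v], whose norm is known, rather than on the iterate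
    [w]. *)
Lemma direction_split n m (A B : 'M[R]_(n, m)) (p q : 'cV[R]_n) (w v : 'cV[R]_m) :
  p - A *m w - (q - B *m v) = (p - q) - A *m (w - v) - (A *m v - B *m v).
Proof.
rewrite mulmxBr; move: (A *m w) (A *m v) (B *m v) => r s t.
by apply/matrixP => i j; rewrite !mxE; ring.
Qed.

End MatrixIdentities.

Section UpperLevel.
Context {R : realType} {n m : nat} (X : set 'cV[R]_n)
  (f g : 'cV[R]_n -> 'cV[R]_m -> R)
  (mu L Fxx Fxy Fyx Fyy Cyx Lyx Lyy Lam Gmax : R).
Context (m_gt0 : (0 < m)%N) (X_conv : convex_set X)
  (f_hyp : f_assumption X f Fxx Fxy Fyx Fyy)
  (g_hyp : g_assumption X g mu L Cyx Lyx Lyy).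
Context (FxxLam : `|Fxx| <= Lam) (FxyLam : `|Fxy| <= Lam)
  (FyxLam : `|Fyx| <= Lam) (FyyLam : `|Fyy| <= Lam)
  (CyxLam : `|Cyx| <= Lam) (LyxLam : `|Lyx| <= Lam) (LyyLam : `|Lyy| <= Lam).
Context (Gmax_ge0 : 0 <= Gmax)
  (grad_bound : forall x, X x -> enorm (grad_y f x (ystar g x)) <= Gmax).
Let mu0 := g_mu_gt0 g_hyp.
Let y_ x := ystar g x.
(** [tau] bounds the motion of the pair (x, y* x) relative to that of x; [omega] is one plus a bound
    for |v*|, the factor by which errors in the Hessians are amplified. *)
Let tau := 1 + Lam / mu.
Let omega := 1 + Gmax / mu.

Let Lam0 : 0 <= Lam. Proof. exact: le_trans CyxLam. Qed.
Let tau1 : 1 <= tau. Proof. by rewrite lerDl divr_ge0// ltW. Qed.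
Let omega1 : 1 <= omega. Proof. by rewrite lerDl divr_ge0// ltW. Qed.

Definition adjoint_star x : 'cV[R]_m :=
  invmx (hess_yy g x (ystar g x)) *m grad_y f x (ystar g x).
Let v_ := adjoint_star.

Lemma hess_adjoint_star x : X x -> hess_yy g x (y_ x) *m v_ x = grad_y f x (y_ x).
Proof. by move=> Xx; rewrite mulKVmx// (hess_yy_unit m_gt0 g_hyp). Qed.

Lemma adjoint_star_norm x : X x -> enorm (v_ x) <= Gmax / mu.
Proof.
move=> Xx; rewrite ler_pdivlMr// mulrC.
apply: le_trans (hess_yy_lower m_gt0 g_hyp (y_ x) (v_ x) Xx) _.
by rewrite hess_adjoint_star// grad_bound.
Qed.

Lemma grad_ellE x :
  grad_ell f g x = grad_x f x (y_ x) - hess_yx g x (y_ x) *m v_ x.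
Proof. by rewrite /grad_ell -mulmxA. Qed.

Lemma grad_x_f_lipschitz x x' y y' : X x -> X x' ->
  enorm (grad_x f x y - grad_x f x' y') <= Lam * (enorm (x - x') + enorm (y - y')).
Proof.
move=> Xx Xx'; apply: le_trans (f_grad_x_lip f_hyp _ _ Xx Xx') _.
by rewrite mulrDr lerD// ler_wpM2r ?enorm_ge0// (le_trans (ler_norm _)).
Qed.

Lemma grad_y_f_lipschitz x x' y y' : X x -> X x' ->
  enorm (grad_y f x y - grad_y f x' y') <= Lam * (enorm (x - x') + enorm (y - y')).
Proof.
move=> Xx Xx'; apply: le_trans (f_grad_y_lip f_hyp _ _ Xx Xx') _.
by rewrite mulrDr lerD// ler_wpM2r ?enorm_ge0// (le_trans (ler_norm _)).
Qed.

Lemma displacement_le x x' : X x -> X x' ->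
  enorm (x' - x) + enorm (y_ x' - y_ x) <= tau * enorm (x' - x).
Proof.
move=> Xx Xx'; rewrite /tau mulrDl mul1r lerD2l.
exact: (ystar_lipschitz g_hyp CyxLam).
Qed.

Lemma ystar_lipschitz_tau x x' : X x -> X x' ->
  enorm (y_ x' - y_ x) <= tau * enorm (x' - x).
Proof.
move=> Xx Xx'; apply: le_trans (displacement_le Xx Xx').
by rewrite lerDr enorm_ge0.
Qed.

(* Both terms of the residual of the linear system defining v* carry the same
   error; the Hessian one is amplified by |v*|. *)
Lemma residual_le x x' y' : X x -> X x' ->
  enorm ((grad_y f x' y' - grad_y f x (y_ x))
     - (hess_yy g x' y' *m v_ x - hess_yy g x (y_ x) *m v_ x))
  <= Lam * omega * (enorm (x' - x) + enorm (y' - y_ x)).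
Proof.
move=> Xx Xx'; apply: le_trans (enormB _ _) _.
set S := enorm (x' - x) + _; have S0 : 0 <= S by rewrite addr_ge0 ?enorm_ge0.
have h1 : enorm (grad_y f x' y' - grad_y f x (y_ x)) <= Lam * S.
  exact: grad_y_f_lipschitz.
have h2 : enorm (hess_yy g x' y' *m v_ x - hess_yy g x (y_ x) *m v_ x)
    <= Lam * (Gmax / mu) * S.
  apply: le_trans (hess_yy_lipschitz g_hyp LyyLam _ _ _ Xx' Xx) _.
  by rewrite ler_wpM2r// ler_wpM2l// adjoint_star_norm.
apply: le_trans (lerD h1 h2) _.
by rewrite /omega [Lam * (1 + _)]mulrDr mulr1 mulrDl.
Qed.

(** One factor [tau] is the displacement of (x, y* x); the other absorbs Lam / mu, the cost of
    inverting the Hessian. *)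
Lemma adjoint_star_lipschitz x x' : X x -> X x' ->
  enorm (v_ x' - v_ x) <= tau ^+ 2 * omega * enorm (x' - x).
Proof.
move=> Xx Xx'.
have h1 := hess_yy_lower m_gt0 g_hyp (y_ x') (v_ x' - v_ x) Xx'.
have e := mulmx_sub_residual (hess_adjoint_star Xx) (hess_adjoint_star Xx').
rewrite e in h1.
have h2 := le_trans h1 (residual_le (y_ x') Xx Xx').
have h3 : Lam * omega * (enorm (x' - x) + enorm (y_ x' - y_ x))
    <= Lam * omega * (tau * enorm (x' - x)).
  by rewrite ler_wpM2l ?mulr_ge0 ?displacement_le// (le_trans ler01).
rewrite -(ler_pM2l mu0); apply: le_trans (le_trans h2 h3) _.
have -> : mu * (tau ^+ 2 * omega * enorm (x' - x))
    = mu * tau * omega * (tau * enorm (x' - x)) by ring.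
have t0 : 0 <= tau * enorm (x' - x) by rewrite mulr_ge0 ?enorm_ge0// (le_trans ler01).
rewrite ler_wpM2r// ler_wpM2r ?(le_trans ler01)//.
have -> : mu * tau = mu + Lam by rewrite /tau; field; rewrite gt_eqF.
by rewrite lerDr ltW.
Qed.

Lemma ell_descent x x' : X x -> X x' ->
  ell f g x' <= ell f g x + dot (x' - x) (grad_ell f g x)
    + 2 * Lam * omega * tau ^+ 2 * enorm (x' - x) ^+ 2.
Proof.
move=> Xx Xx'.
have df x1 y1 : X x1 -> differentiable (fun q => f q.1 q.2) (x1, y1).
  have [U [XU [_ /(_ (x1, y1)) h]]] := f_C1 f_hyp.
  by move=> Xx1; have [] := h (XU (x1, y1) (conj Xx1 I)).
have vG := adjoint_star_norm Xx; have dS := displacement_le Xx Xx'.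
set S := enorm (x' - x) + _ in dS.
have h1 : f x' (y_ x') <= f x (y_ x) + dot (x' - x) (grad_x f x (y_ x))
    + dot (y_ x' - y_ x) (grad_y f x (y_ x)) + (Lam + Lam) * S ^+ 2.
  by apply: (first_order_remainder (y_ x') df X_conv Xx Xx' Lam0 Lam0) => x1 y1 Xx1;
    [exact: grad_x_f_lipschitz | exact: grad_y_f_lipschitz].
(* The linearised optimality condition is tested at [- v_ x]: since H v* = [grad_y f], it trades the
   y-part of the expansion of [f] for the [hess_yx] part of [grad_ell]. *)
have h2 : dot (x' - x) (hess_yx g x (y_ x) *m v_ x)
    + dot (y_ x' - y_ x) (grad_y f x (y_ x)) <= 2 * Lam * enorm (v_ x) * S ^+ 2.
  have := ystar_linearised X_conv g_hyp CyxLam LyxLam LyyLam (- v_ x) Xx Xx'.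
  by rewrite !mulmxN !dotNr enormN !opprK; have <- := hess_adjoint_star Xx.
have S0 : 0 <= S by rewrite addr_ge0 ?enorm_ge0.
have S2 : S ^+ 2 <= (tau * enorm (x' - x)) ^+ 2.
  by rewrite ler_sqr// nnegrE mulr_ge0 ?enorm_ge0// (le_trans ler01).
have h3 : 2 * Lam * (1 + enorm (v_ x)) * S ^+ 2
    <= 2 * Lam * omega * (tau * enorm (x' - x)) ^+ 2.
  have : 2 * Lam * (1 + enorm (v_ x)) <= 2 * Lam * omega.
    by rewrite ler_wpM2l ?mulr_ge0// lerD2l.
  move=> h; apply: ler_pM => //; last by rewrite sqr_ge0.
  by rewrite !mulr_ge0// addr_ge0// enorm_ge0.
rewrite grad_ellE dotBr /ell; move: h1 h2 h3; rewrite exprMn.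
move: (dot _ _) (dot _ _) (dot _ _) => p q r; rewrite -/(y_ x) -/(y_ x').
lra.
Qed.

(** Stated for inner products with feasible displacements because [hess_yx] is bounded only along
    these; the absolute value comes from applying that one-sided bound to [w - v_ x] and to its
    opposite. *)
Lemma direction_error x x' y w : X x -> X x' ->
  `|dot (x' - x) (ibcg_direction f g x y w - grad_ell f g x)|
  <= Lam * (omega * enorm (y - y_ x) + enorm (w - v_ x)) * enorm (x' - x).
Proof.
move=> Xx Xx'; rewrite grad_ellE /ibcg_direction.
rewrite direction_split.
set N := enorm (x' - x); have N0 : 0 <= N := enorm_ge0 _.
set a := enorm (y - y_ x); have a0 : 0 <= a := enorm_ge0 _.
have dot_norm (u : 'cV[R]_n) b : enorm u <= b -> `|dot (x' - x) u| <= b * N.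
  move=> ub; apply: (@le_trans _ _ (N * enorm u)).
    by rewrite ler_norml dot_ge dot_le.
  by rewrite mulrC ler_wpM2r.
have h1 : `|dot (x' - x) (grad_x f x y - grad_x f x (y_ x))| <= Lam * a * N.
  apply: dot_norm; apply: le_trans (grad_x_f_lipschitz _ _ Xx Xx) _.
  by rewrite subrr enorm0 add0r.
have h2 : `|dot (x' - x) (hess_yx g x y *m (w - v_ x))| <= Lam * enorm (w - v_ x) * N.
  have := hess_yx_le X_conv g_hyp CyxLam y (- (w - v_ x)) Xx Xx'.
  rewrite enormN mulmxN dotNr => hN.
  by rewrite ler_norml lerNl hN (hess_yx_le X_conv g_hyp CyxLam).
have h3 : `|dot (x' - x) (hess_yx g x y *m v_ x - hess_yx g x (y_ x) *m v_ x)|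
    <= Lam * (Gmax / mu) * a * N.
  apply: dot_norm; apply: le_trans (hess_yx_lipschitz g_hyp LyxLam _ _ _ Xx Xx) _.
  by rewrite subrr enorm0 add0r ler_wpM2r// ler_wpM2l// adjoint_star_norm.
rewrite 2!dotBr; apply: le_trans (ler_normB _ _) _.
apply: le_trans (lerD (ler_normB _ _) h3) _.
by rewrite /omega; lra.
Qed.

Lemma ibcg_etaE (c : R) x : X x -> ibcg_eta c mu L = c * ibcg_alpha mu L.
Proof.
move=> Xx; rewrite /ibcg_eta /ibcg_alpha /ibcg_beta.
have L0 : 0 < L := lt_le_trans mu0 (mu_le_Lg m_gt0 g_hyp Xx).
by field; rewrite !gt_eqF ?addr_gt0.
Qed.

Lemma adjoint_step (c : R) x y w : 0 <= c <= 1 -> X x ->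
  enorm ((1%:M - ibcg_eta c mu L *: hess_yy g x y) *m w
     + ibcg_eta c mu L *: grad_y f x y - v_ x)
  <= (1 - c * (1 - ibcg_beta mu L)) * enorm (w - v_ x)
     + ibcg_eta c mu L * (Lam * omega) * enorm (y - y_ x).
Proof.
move=> /andP[c0 c1] Xx; rewrite (ibcg_etaE c Xx).
set al := ibcg_alpha mu L; set u := w - v_ x.
have al0 : 0 <= al.
  by rewrite divr_ge0// addr_ge0 ?(le_trans (ltW mu0) (mu_le_Lg m_gt0 g_hyp Xx))// ltW.
rewrite (relaxed_step_split _ _ _ _ _ (hess_adjoint_star Xx)) -/u.
have hr := residual_le y Xx Xx.
rewrite (subrr x) enorm0 add0r in hr.
have hc := hess_yy_contract m_gt0 g_hyp y u Xx.
apply: le_trans (enormD _ _) _; apply: le_trans (lerD (enormD _ _) (lexx _)) _.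
have n1 : `|1 - c| = 1 - c by rewrite ger0_norm ?subr_ge0.
rewrite !enormZ n1 (ger0_norm c0) (ger0_norm (mulr_ge0 c0 al0)).
have := ler_wpM2l c0 hc; have := ler_wpM2l (mulr_ge0 c0 al0) hr.
rewrite -/al; lra.
Qed.

Lemma fw_gap_le (B : R) x : X !=set0 ->
  (forall s, X s -> dot (grad_ell f g x) (x - s) <= B) -> fw_gap X f g x <= B.
Proof.
move=> [s0 Xs0] h; apply: ge_sup; first by exists (dot (grad_ell f g x) (x - s0)), s0.
by move=> _ [s Xs <-]; exact: h.
Qed.

End UpperLevel.

(** * Summation of the error recursions *)

Section Rate.
Context {R : realType}.

(** Telescoping bounds the total error by 1/rho times its inputs, without unrolling a geometric
    series. *)
Lemma sum_contraction (rho : R) (u r : nat -> R) K :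
  (forall j, (j < K)%N -> u j.+1 <= (1 - rho) * u j + r j) ->
  u K + rho * (\sum_(j < K) u j) <= u 0%N + \sum_(j < K) r j.
Proof.
elim: K => [|K IH] h; first by rewrite !big_ord0 mulr0.
have := IH (fun j jK => h j (ltnW jK)); have := h K (ltnSn K).
rewrite !big_ord_recr /=; lra.
Qed.

(* With gamma of order 1 / (k^2 sqrt (s K)), every error term is of order
   q = k^2 sqrt (s / K) or q^2. *)
Lemma averaged_rate (K : nat) (k s c gamma B eps : R) (a d l e : nat -> R) :
  (0 < K)%N -> 1 <= k -> 1 <= s -> 0 < c <= 1 -> 0 < gamma -> 0 <= B ->
  0 < eps <= 1 -> gamma ^+ 2 * (k ^+ 4 * s * K%:R) = 1 ->
  (forall j, 0 <= a j) -> (forall j, 0 <= d j) ->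
  a 0%N <= B -> d 0%N <= B * (s * k) -> l 0%N - l K <= B ->
  (forall j, (j < K)%N -> a j.+1 <= (1 - k^-1) * a j + B * k * gamma) ->
  (forall j, (j < K)%N ->
    d j.+1 <= (1 - c / k) * d j + (B * (s * k) * a j + B * (s * k ^+ 3) * gamma)) ->
  (forall j, (j < K)%N -> gamma * e j <= l j - l j.+1
    + (B * (s * k ^+ 3) * gamma ^+ 2 + gamma * (B * (s * k) * a j + B * d j))) ->
  (1 + 2 * B + 2 * (B ^+ 2 + B * (B + B ^+ 2) / c)) ^+ 2 * (k ^+ 4 * s) / eps ^+ 2
    <= K%:R ->
  exists j, (j < K)%N /\ e j <= eps.
Proof.
move=> K0 k1 s1 /andP[c0 c1] g0 B0 /andP[e0 e1] gE a_ge0 d_ge0 a0 d0 l0 ha hd he hK.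
apply: contrapT => /forallNP hn.
have {hn} hgt j : (j < K)%N -> eps < e j.
  by move=> jK; rewrite ltNge; apply/negP => ej; exact: (hn j).
have Kp : 0 < K%:R :> R by rewrite ltr0n.
have kp : 0 < k by exact: lt_le_trans k1.
have sp : 0 < s by exact: lt_le_trans s1.
set N1 := B ^+ 2 + B * (B + B ^+ 2) / c in hK.
have N10 : 0 <= N1.
  by rewrite addr_ge0 ?sqr_ge0// divr_ge0 ?mulr_ge0 ?addr_ge0 ?sqr_ge0// ltW.
pose SA := \sum_(j < K) a j; pose SD := \sum_(j < K) d j.
(* Common majorant, up to constants, of [s * k * SA] and [SD]. By [gE] the second summand of
   [gamma * P] is exactly 1. *)
pose P := s * k ^+ 3 + K%:R * (s * k ^+ 4) * gamma.
have hSA : SA <= B * k + K%:R * B * k ^+ 2 * gamma.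
  have := sum_contraction ha; rewrite sumr_const card_ord -mulr_natl -/SA => h.
  have : k^-1 * SA <= B + K%:R * (B * k * gamma) by have := a_ge0 K; lra.
  by rewrite mulrC ler_pdivrMr// => /le_trans; apply; rewrite le_eqVlt; apply/orP; left; apply/eqP; ring.
have k23 : k ^+ 2 <= k ^+ 3 by rewrite [leRHS]exprS ler_peMl// exprn_ge0// ltW.
have k34 : k ^+ 3 <= k ^+ 4 by rewrite [leRHS]exprS ler_peMl// exprn_ge0// ltW.
have k12 : k <= k ^+ 2 by rewrite [leRHS]exprS expr1 ler_peMl// ltW.
have sk0 : 0 <= s * k by rewrite mulr_ge0 ?ltW.
have Kg0 : 0 <= K%:R * gamma by rewrite mulr_ge0 ?ltW.
have hskSA : s * k * SA <= B * (s * k ^+ 2 + K%:R * (s * k ^+ 3) * gamma).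
  apply: le_trans (ler_wpM2l sk0 hSA) _.
  by rewrite le_eqVlt; apply/orP; left; apply/eqP; ring.
have hSD : c * SD <= (B + B ^+ 2) * P.
  have := sum_contraction hd; rewrite big_split /= -mulr_sumr sumr_const card_ord.
  rewrite -mulr_natl -/SA -/SD => h.
  have h1 : c / k * SD <= B * (s * k) + B * (s * k * SA) + K%:R * (B * (s * k ^+ 3) * gamma).
    by have := d_ge0 K; lra.
  have h2 : B * (s * k) <= B * (s * k ^+ 2) by rewrite ler_wpM2l// ler_wpM2l// ltW.
  have h3 : c / k * SD <= (B + B ^+ 2) * (s * k ^+ 2 + K%:R * (s * k ^+ 3) * gamma).
    by have := ler_wpM2l B0 hskSA; lra.
  rewrite mulrAC ler_pdivrMr// in h3; apply: le_trans h3 _.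
  by rewrite le_eqVlt; apply/orP; left; apply/eqP; rewrite /P; ring.
have P0 : 0 <= P.
  by rewrite addr_ge0// ?mulr_ge0 ?exprn_ge0// ?ltW// ?mulr_gt0 ?exprn_gt0.
have hskSA' : s * k * SA <= B * P.
  apply: le_trans hskSA _; rewrite ler_wpM2l// /P lerD//; first by rewrite ler_wpM2l// ltW.
  by rewrite (ler_wpM2r (ltW g0))// (ler_wpM2l (ltW Kp))// (ler_wpM2l (ltW sp)).
have hSD' : B * SD <= B * (B + B ^+ 2) / c * P.
  rewrite mulrAC ler_pdivlMr// -!mulrA ler_wpM2l// mulrC//.
have hsum : \sum_(j < K) gamma * e j <= l 0%N - l K
    + \sum_(j < K) (B * (s * k ^+ 3) * gamma ^+ 2 + gamma * (B * (s * k) * a j + B * d j)).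
  have tel : \sum_(j < K) (l j - l j.+1) = l 0%N - l K.
    by elim: (K) => [|i IH]; rewrite ?big_ord0 ?subrr// big_ord_recr /= IH; ring.
  rewrite -tel -big_split /=; apply: ler_sum => j _; exact: he.
have hlow : K%:R * gamma * eps <= \sum_(j < K) gamma * e j.
  rewrite -mulrA mulr_natl -[in leLHS](card_ord K) -sumr_const.
  by apply: ler_sum => j _; rewrite ler_pM2l// ltW// hgt.
have hup : K%:R * gamma * eps <= 2 * B + N1 * (gamma * (s * k ^+ 3) + 1).
  have eP : gamma * P = gamma * (s * k ^+ 3) + 1 by rewrite -gE /P; ring.
  have hB : K%:R * (B * (s * k ^+ 3) * gamma ^+ 2) <= B.
    rewrite [leRHS](_ : B = B * (gamma ^+ 2 * (k ^+ 4 * s * K%:R))); last by rewrite gE mulr1.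
    have -> : K%:R * (B * (s * k ^+ 3) * gamma ^+ 2)
      = B * (gamma ^+ 2 * (k ^+ 3 * s * K%:R)) by ring.
    by rewrite ler_wpM2l// ler_wpM2l ?sqr_ge0// (ler_wpM2r (ltW Kp))// (ler_wpM2r (ltW sp)).
  have hN : gamma * (B * (s * k * SA) + B * SD) <= N1 * (gamma * P).
    rewrite [leRHS]mulrCA ler_pM2l// /N1 mulrDl lerD//.
    have -> : B ^+ 2 * P = B * (B * P) by ring.
    exact: ler_wpM2l.
  rewrite eP in hN.
  have eS : \sum_(j < K) (B * (s * k ^+ 3) * gamma ^+ 2 + gamma * (B * (s * k) * a j + B * d j))
      = K%:R * (B * (s * k ^+ 3) * gamma ^+ 2) + gamma * (B * (s * k * SA) + B * SD).
    rewrite big_split /= sumr_const card_ord -mulr_natl -mulr_sumr big_split /=.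
    by rewrite -!mulr_sumr -/SA -/SD; ring.
  rewrite eS in hsum; lra.
(* By [gE] this is k^2 sqrt (s / K), so dividing [hup] by K gamma expresses every term through
   [q]. *)
pose q := (K%:R * gamma)^-1.
have Kgp : 0 < K%:R * gamma by exact: mulr_gt0.
have q0 : 0 < q by rewrite invr_gt0.
have qE : q ^+ 2 = k ^+ 4 * s / K%:R.
  have -> : k ^+ 4 * s / K%:R = gamma ^+ 2 * (k ^+ 4 * s * K%:R) * q ^+ 2.
    by rewrite /q; field; rewrite !gt_eqF.
  by rewrite gE mul1r.
(* The summand 1 closes the contradiction: eps <= q (2 B + 2 N1) < q N <= eps. It also gives q <= q
   N <= 1, hence q^2 <= q. *)
set N := 1 + 2 * B + 2 * N1 in hK.
have N0 : 0 < N by rewrite /N; lra.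
have qN : q * N <= eps.
  rewrite -ler_sqr ?nnegrE ?(mulr_ge0 (ltW q0) (ltW N0)) ?(ltW e0)// exprMn qE.
  move: hK; rewrite ler_pdivrMr ?exprn_gt0// => hK.
  by rewrite [leLHS]mulrAC ler_pdivrMr//; lra.
have q1 : q <= 1.
  apply: le_trans _ (le_trans qN e1); rewrite (ler_peMr (ltW q0))// /N; lra.
have hE : eps <= q * (2 * B + N1) + N1 * q ^+ 2.
  have -> : eps = q * (K%:R * gamma * eps) by rewrite /q mulrA mulVf ?mul1r ?gt_eqF.
  apply: le_trans (ler_wpM2l (ltW q0) hup) _.
  have -> : q * (2 * B + N1 * (gamma * (s * k ^+ 3) + 1))
    = q * (2 * B + N1) + N1 * (k ^+ 3 * s / K%:R).
    by rewrite /q; field; rewrite !gt_eqF.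
  rewrite lerD2l ler_wpM2l// qE ler_wpM2r ?invr_ge0 ?(ltW Kp)// (ler_wpM2r (ltW sp))//.
have : N1 * q ^+ 2 <= N1 * q by rewrite ler_wpM2l// expr2 (ler_piMl (ltW q0)).
move: qN; rewrite /N; lra.
Qed.

End Rate.

(** * The iterates *)

(** The error is paid twice: passing from [G] to [F] at the competitor [s'], and back from [F] to
    [G] at the minimiser [s]. *)
Lemma inexact_minimizer_gap (R : realType) n (F G x s s' : 'cV[R]_n) (err : R) :
  dot F s <= dot F s' ->
  `|dot (s - x) (F - G)| <= err -> `|dot (s' - x) (F - G)| <= err ->
  dot G (x - s') <= - dot (s - x) G + 2 * err.
Proof.
rewrite !ler_norml (dotC F s) (dotC F s') (dotC G) !(dotBl, dotBr).
by move=> h /andP[h1 h2] /andP[h3 h4]; lra.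
Qed.

Section IBCGRun.
Context {R : realType} {n m : nat} (X : set 'cV[R]_n)
  (f g : 'cV[R]_n -> 'cV[R]_m -> R)
  (mu L Fxx Fxy Fyx Fyy Cyx Lyx Lyy Lam Gmax D c gamma : R).
Context (m_gt0 : (0 < m)%N) (X_conv : convex_set X) (X0 : X !=set0)
  (X_diam : forall x x', X x -> X x' -> enorm (x - x') <= D)
  (f_hyp : f_assumption X f Fxx Fxy Fyx Fyy)
  (g_hyp : g_assumption X g mu L Cyx Lyx Lyy).
Context (FxxLam : `|Fxx| <= Lam) (FxyLam : `|Fxy| <= Lam)
  (FyxLam : `|Fyx| <= Lam) (FyyLam : `|Fyy| <= Lam)
  (CyxLam : `|Cyx| <= Lam) (LyxLam : `|Lyx| <= Lam) (LyyLam : `|Lyy| <= Lam).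
Context (Gmax_ge0 : 0 <= Gmax)
  (grad_bound : forall x, X x -> enorm (grad_y f x (ystar g x)) <= Gmax).
Context (c01 : 0 <= c <= 1) (gamma01 : 0 <= gamma <= 1).
Context (x0 : 'cV[R]_n) (y0 : 'cV[R]_m) (K : nat) (xs : nat -> 'cV[R]_n)
  (ys ws : nat -> 'cV[R]_m) (ss : nat -> 'cV[R]_n).
Context (Xx0 : X x0) (run : ibcg_run X f g (fun=> gamma)
  (fun=> ibcg_eta c mu L) (ibcg_alpha mu L) x0 y0 K xs ys ws ss).
Let mu0 := g_mu_gt0 g_hyp.
Let tau := 1 + Lam / mu.
Let omega := 1 + Gmax / mu.
Let beta := ibcg_beta mu L.
Let eta := ibcg_eta c mu L.

Let Lam0 : 0 <= Lam. Proof. exact: le_trans CyxLam. Qed.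
Let tau0 : 0 <= tau. Proof. by rewrite addr_ge0// divr_ge0// ltW. Qed.
Let omega0 : 0 <= omega. Proof. by rewrite addr_ge0// divr_ge0// ltW. Qed.
Let D0 : 0 <= D. Proof. exact: (le_trans (enorm_ge0 _) (X_diam Xx0 Xx0)). Qed.
Let muL : mu <= L. Proof. exact: (mu_le_Lg m_gt0 g_hyp Xx0). Qed.
Let beta01 : 0 <= beta <= 1.
Proof.
have L0 : 0 < L + mu by rewrite addr_gt0 ?(lt_le_trans mu0).
rewrite divr_ge0 ?subr_ge0 ?(ltW L0)//= ler_pdivrMr// mul1r.
by rewrite lerBlDr -addrA lerDl addr_ge0// ltW.
Qed.
Let eta0 : 0 <= eta.
Proof.
have /andP[_ b1] := beta01; have /andP[c0 _] := c01.
by rewrite mulr_ge0// divr_ge0 ?subr_ge0// ltW.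
Qed.

Definition lower_error j := enorm (ys j - ystar g (xs j)).
Definition adjoint_error j := enorm (ws j - adjoint_star f g (xs j)).

Lemma run_stepE j : (j < K)%N -> xs j.+1 = xs j + gamma *: (ss j - xs j).
Proof.
move=> jK; rewrite (run_x run jK) scalerBl scale1r scalerBr.
by rewrite -addrA [- _ + _]addrC.
Qed.

Lemma run_in j : (j <= K)%N -> X (xs j).
Proof.
elim: j => [_|j IH jK]; first by rewrite (run_x0 run).
rewrite run_stepE//; apply: convex_set_segment => //; first exact: (IH (ltnW jK)).
exact: (run_s_in run).
Qed.

Lemma run_step_le j : (j < K)%N -> enorm (xs j.+1 - xs j) <= gamma * D.
Proof.
move=> jK; rewrite run_stepE// addrAC subrr add0r enormZ.
have /andP[g0 _] := gamma01; rewrite ger0_norm// ler_wpM2l//.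
by apply: X_diam; [exact: (run_s_in run) | exact: (run_in (ltnW jK))].
Qed.

(** The lower-level step is taken at the new x, so the target moves before the contraction and beta
    multiplies the drift too. *)
Lemma lower_error_step j : (j < K)%N ->
  lower_error j.+1 <= beta * (lower_error j + tau * (gamma * D)).
Proof.
move=> jK; have Xj := run_in (ltnW jK); have Xj1 := run_in jK.
have /andP[b0 _] := beta01.
have := grad_y_step_contract m_gt0 g_hyp (ystar g (xs j.+1)) (ys j) Xj1.
rewrite (grad_y_ystar g_hyp Xj1) scaler0 subr0 -(run_y run jK) => h.
apply: le_trans h _; rewrite ler_wpM2l//.
apply: le_trans (enorm_dist_trans (ystar g (xs j)) _ _) _; rewrite lerD2l.
apply: le_trans (ystar_lipschitz_tau g_hyp CyxLam Xj1 Xj) _.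
by rewrite enormBC ler_wpM2l// run_step_le.
Qed.

(** Measured before the target moves, because the direction at step [j] combines [ws j.+1] with
    [xs j]. *)
Lemma adjoint_error_half_step j : (j < K)%N ->
  enorm (ws j.+1 - adjoint_star f g (xs j))
  <= (1 - c * (1 - beta)) * adjoint_error j + eta * (Lam * omega) * lower_error j.
Proof.
move=> jK; rewrite (run_w run jK).
exact: (adjoint_step m_gt0 f_hyp g_hyp FyxLam FyyLam CyxLam LyyLam grad_bound
  _ _ c01 (run_in (ltnW jK))).
Qed.

Lemma adjoint_error_step j : (j < K)%N ->
  adjoint_error j.+1 <= (1 - c * (1 - beta)) * adjoint_error j
    + eta * (Lam * omega) * lower_error j + tau ^+ 2 * omega * (gamma * D).
Proof.
move=> jK; have Xj := run_in (ltnW jK); have Xj1 := run_in jK.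
apply: le_trans (enorm_dist_trans (adjoint_star f g (xs j)) _ _) _.
apply: lerD; first exact: adjoint_error_half_step.
apply: le_trans (adjoint_star_lipschitz m_gt0 f_hyp g_hyp FyxLam FyyLam CyxLam LyyLam
  Gmax_ge0 grad_bound Xj1 Xj) _.
by rewrite enormBC ler_wpM2l ?mulr_ge0 ?sqr_ge0// run_step_le.
Qed.

Lemma fw_gap_step j : (j < K)%N ->
  gamma * fw_gap X f g (xs j) <= ell f g (xs j) - ell f g (xs j.+1)
    + 2 * Lam * omega * tau ^+ 2 * (gamma * D) ^+ 2
    + gamma * (2 * (Lam * (omega * lower_error j
        + enorm (ws j.+1 - adjoint_star f g (xs j))) * D)).
Proof.
move=> jK; have Xj := run_in (ltnW jK); have Xj1 := run_in jK.
have Xs := run_s_in run jK; have /andP[g0 _] := gamma01.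
set x := xs j in Xj *; set w := ws j.+1.
pose F := ibcg_direction f g x (ys j) w.
set err := Lam * (omega * lower_error j + enorm (w - adjoint_star f g x)) * D.
have herr s : X s -> `|dot (s - x) (F - grad_ell f g x)| <= err.
  move=> Xs'; have h := direction_error m_gt0 X_conv f_hyp g_hyp FxxLam FxyLam CyxLam LyxLam
    grad_bound (ys j) w Xj Xs'.
  apply: le_trans h _; rewrite ler_wpM2l ?X_diam//.
  by rewrite mulr_ge0// addr_ge0 ?mulr_ge0 ?enorm_ge0.
have hgap : fw_gap X f g x <= - dot (ss j - x) (grad_ell f g x) + 2 * err.
  apply: fw_gap_le => // s Xs'.
  exact: inexact_minimizer_gap (run_s_min run jK Xs') (herr _ Xs) (herr _ Xs').
have hd := ell_descent m_gt0 X_conv f_hyp g_hyp FxxLam FxyLam FyxLam FyyLam CyxLam LyxLam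
  LyyLam grad_bound Xj Xj1.
have hstep : xs j.+1 - x = gamma *: (ss j - x).
  by rewrite run_stepE// addrAC subrr add0r.
have hN : 2 * Lam * omega * tau ^+ 2 * enorm (xs j.+1 - x) ^+ 2
    <= 2 * Lam * omega * tau ^+ 2 * (gamma * D) ^+ 2.
  apply: ler_wpM2l; first by rewrite !mulr_ge0 ?sqr_ge0.
  by rewrite ler_sqr ?nnegrE ?enorm_ge0 ?mulr_ge0// run_step_le.
rewrite -/tau -/omega in hd.
have hdot : dot (xs j.+1 - x) (grad_ell f g x) = gamma * dot (ss j - x) (grad_ell f g x).
  by rewrite hstep dotZl.
rewrite hdot in hd.
by have := ler_wpM2l g0 hgap; lra.
Qed.

End IBCGRun.

(** * Iteration complexity *)

Section Complexity.
Context {R : realType}.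

Lemma kappa_bounds (mu L : R) : 0 < mu -> mu <= L ->
  [/\ 1 <= kappa_g mu L, (kappa_g mu L)^-1 <= 1 - ibcg_beta mu L &
      1 - ibcg_beta mu L <= 1].
Proof.
move=> mu0 muL; have L0 : 0 < L by exact: lt_le_trans muL.
have Lm0 : 0 < L + mu by rewrite addr_gt0.
split; first by rewrite ler_pdivlMr// mul1r.
- rewrite /kappa_g /ibcg_beta invf_div.
  have -> : 1 - (L - mu) / (L + mu) = 2 * mu / (L + mu) by field; rewrite gt_eqF.
  rewrite ler_pdivrMr// mulrAC ler_pdivlMr// (mulrC 2) -!mulrA ler_pM2l//; lra.
- by rewrite gerBl divr_ge0 ?subr_ge0// ltW.
Qed.

(** The upper bound is free of [mu], as the uniform constant requires. *)
Lemma ibcg_eta_le (c mu L : R) : 0 <= c <= 1 -> 0 < mu -> mu <= L ->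
  0 <= ibcg_eta c mu L <= 2 / L.
Proof.
move=> /andP[c0 c1] mu0 muL; have L0 : 0 < L by exact: lt_le_trans muL.
have Lm0 : 0 < L + mu by rewrite addr_gt0.
have -> : ibcg_eta c mu L = c * (2 / (L + mu)).
  by rewrite /ibcg_eta /ibcg_beta; field; rewrite !gt_eqF.
have h : 2 / (L + mu) <= 2 / L by rewrite ler_pM2l// lef_pV2 ?posrE// lerDl ltW.
have h0 : 0 <= 2 / (L + mu) by rewrite divr_ge0// ltW.
by rewrite mulr_ge0//= (le_trans _ h)// ler_piMl.
Qed.

Lemma ler_sum_mem (r : seq R) x :
  all (fun y => 0 <= y) r -> x \in r -> x <= \sum_(y <- r) y.
Proof.
move=> /allP r0 xr; rewrite (big_rem x)//= lerDl big_seq sumr_ge0// => y /mem_rem.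
exact: r0.
Qed.

(** Serves both regimes: [C] is fixed before [mu] and [s], and the step size enters only through the
    equation for its square, so that s = kappa and s = 1 give the two claimed orders. *)
Lemma ibcg_complexity (c L Fxx Fxy Fyx Fyy Cyx Lyx Lyy D dy0 nw0 dl0 nfy G : R) :
  0 < c < 1 -> 0 <= G ->
  exists C : R, 0 < C /\
    forall (n m : nat) (X : set 'cV[R]_n) (f g : 'cV[R]_n -> 'cV[R]_m -> R)
      (mu : R) (x0 : 'cV[R]_n) (y0 : 'cV[R]_m) (xstar : 'cV[R]_n),
    bilevel_setting X f g mu L Fxx Fxy Fyx Fyy Cyx Lyx Lyy D
      x0 y0 xstar dy0 nw0 dl0 nfy ->
    forall s : R, 1 <= s ->
    (forall x, X x -> enorm (grad_y f x (ystar g x)) <= G * s) ->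
    forall eps : R, 0 < eps <= 1 ->
    exists K : nat, [/\ (0 < K)%N,
      K%:R <= C * (s * kappa_g mu L ^+ 4) * eps ^- 2 &
      forall (gamma : R) (xs : nat -> 'cV[R]_n) (ys ws : nat -> 'cV[R]_m)
        (ss : nat -> 'cV[R]_n),
      0 < gamma -> gamma ^+ 2 * (kappa_g mu L ^+ 4 * s * K%:R) = 1 ->
      ibcg_run X f g (fun=> gamma) (fun=> ibcg_eta c mu L) (ibcg_alpha mu L)
        x0 y0 K xs ys ws ss ->
      exists j : nat, (j < K)%N /\ fw_gap X f g (xs j) <= eps].
Proof.
move=> /andP[c0 c1] G0.
(* A sum stands in for a maximum; absolute values are taken because no sign is assumed for the
   constants. *)
pose Lam := \sum_(y <- [:: `|Fxx|; `|Fxy|; `|Fyx|; `|Fyy|; `|Cyx|; `|Lyx|; `|Lyy|]) y.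
(* The [mu]-free parts of [tau] and [omega]: once a setting makes L positive, tau <= T k and omega
   <= W s k. *)
pose T := 1 + Lam / `|L|; pose W := 1 + G / `|L|.
(* In order: drift of y*, influence of the lower error on the adjoint, drift of v*, the descent
   remainder, the coefficients of the lower and adjoint errors in the gap, and the three initial
   quantities. *)
pose Bs := [:: T * `|D|; 2 * Lam * W / `|L|; T ^+ 2 * W * `|D|;
  2 * Lam * W * T ^+ 2 * `|D| ^+ 2; 2 * Lam * `|D| * (1 + 2 * Lam / `|L|) * W;
  2 * Lam * `|D|; `|dy0|; `|nw0| + W; `|dl0|].
pose B := \sum_(y <- Bs) y.
have [[hFxx hFxy hFyx hFyy] [hCyx hLyx hLyy]] :
    [/\ `|Fxx| <= Lam, `|Fxy| <= Lam, `|Fyx| <= Lam & `|Fyy| <= Lam] /\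
    [/\ `|Cyx| <= Lam, `|Lyx| <= Lam & `|Lyy| <= Lam].
  by split; split; apply: ler_sum_mem; rewrite /= ?normr_ge0// !inE eqxx ?orbT.
have Lam0 : 0 <= Lam by exact: le_trans hCyx.
have T1 : 1 <= T by rewrite lerDl divr_ge0.
have W1 : 1 <= W by rewrite lerDl divr_ge0.
have T0 : 0 <= T by exact: le_trans T1.
have W0 : 0 <= W by exact: le_trans W1.
clearbody Lam.
have D0 := normr_ge0 D.
have b1 : 0 <= T * `|D| by rewrite mulr_ge0.
have b2 : 0 <= 2 * Lam * W / `|L| by rewrite divr_ge0// !mulr_ge0.
have b3 : 0 <= T ^+ 2 * W * `|D| by rewrite !mulr_ge0// exprn_ge0.
have b4 : 0 <= 2 * Lam * W * T ^+ 2 * `|D| ^+ 2 by rewrite !mulr_ge0// exprn_ge0.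
have b5 : 0 <= 2 * Lam * `|D| * (1 + 2 * Lam / `|L|) * W.
  by rewrite !mulr_ge0// addr_ge0// divr_ge0// mulr_ge0.
have b6 : 0 <= 2 * Lam * `|D| by rewrite !mulr_ge0.
have b7 := normr_ge0 dy0; have b9 := normr_ge0 dl0.
have b8 : 0 <= `|nw0| + W by rewrite addr_ge0.
have Bs0 : all (fun y => 0 <= y) Bs.
  by rewrite /= b1 b2 b3 b4 b5 b6 b7 b8 b9.
have [B1 B2 B3 B4] : [/\ T * `|D| <= B, 2 * Lam * W / `|L| <= B,
    T ^+ 2 * W * `|D| <= B & 2 * Lam * W * T ^+ 2 * `|D| ^+ 2 <= B].
  by split; apply: ler_sum_mem => //; rewrite !inE eqxx ?orbT.
have [B5 B6 B7 B8] : [/\ 2 * Lam * `|D| * (1 + 2 * Lam / `|L|) * W <= B,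
    2 * Lam * `|D| <= B, `|dy0| <= B & `|nw0| + W <= B].
  by split; apply: ler_sum_mem => //; rewrite !inE eqxx ?orbT.
have B9 : `|dl0| <= B by apply: ler_sum_mem => //; rewrite !inE eqxx ?orbT.
have B0 : 0 <= B by exact: le_trans B9.
clearbody B; clear Bs0 b1 b2 b3 b4 b5 b6 b7 b8 b9.
pose N := 1 + 2 * B + 2 * (B ^+ 2 + B * (B + B ^+ 2) / c).
have N1 : 1 <= N.
  have : 0 <= B * (B + B ^+ 2) / c.
    by rewrite divr_ge0 ?mulr_ge0 ?addr_ge0 ?sqr_ge0// ltW.
  by move=> h; rewrite /N -addrA lerDl addr_ge0// mulr_ge0// addr_ge0// sqr_ge0.
(* The factor 2 pays for rounding: the chosen K satisfies V < K <= V + 1 <= 2 V, where V >= 1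
   because eps <= 1. *)
exists (2 * N ^+ 2); split; first by rewrite mulr_gt0// exprn_gt0// (lt_le_trans ltr01).
move=> n m X f g mu x0 y0 xstar S s s1 hG eps /andP[e0 e1].
have m0 := dim_y S; have cX := X_convex S; have fh := f_ok S; have gh := g_ok S.
have mu0 := g_mu_gt0 gh; have Xx0 := x0_in S.
have muL : mu <= L := mu_le_Lg m0 gh Xx0.
have L0 : 0 < L by exact: lt_le_trans muL.
have [k1 kb b01] := kappa_bounds mu0 muL.
have c01 : 0 <= c <= 1 by rewrite !ltW.
have /andP[eta0 etaL] := ibcg_eta_le c01 mu0 muL.
have s0 : 0 < s by exact: lt_le_trans s1.
have Dge0 : 0 <= D by exact: le_trans (enorm_ge0 _) (X_diameter S Xx0 Xx0).
rewrite (ger0_norm Dge0) (ger0_norm (ltW L0)) in B1 B2 B3 B4 B5 B6 *.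
rewrite /T /W (ger0_norm (ltW L0)) in T0 W0 T1 W1 B1 B2 B3 B4 B5 B6 B8.
move: T0 W0 T1 W1 B1 B2 B3 B4 B5 B6 B8.
set T' := 1 + Lam / L; set W' := 1 + G / L => T0 W0 T1 W1 B1 B2 B3 B4 B5 B6 B8.
pose k := kappa_g mu L; rewrite -/k in k1 kb *.
have k0 : 0 < k by exact: lt_le_trans k1.
have sk1 : 1 <= s * k by exact: mulr_ege1.
pose tau := 1 + Lam / mu; pose omega := 1 + G * s / mu.
have tauk : tau <= T' * k.
  have -> : T' * k = k + Lam / mu by rewrite /T' /k /kappa_g; field; rewrite !gt_eqF.
  by rewrite lerD2r.
have omegak : omega <= W' * (s * k).
  have -> : W' * (s * k) = s * k + G * s / mu.
    by rewrite /W' /k /kappa_g; field; rewrite !gt_eqF.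
  by rewrite lerD2r.
have Gs0 : 0 <= G * s by rewrite mulr_ge0// ltW.
have tau0 : 0 <= tau by rewrite addr_ge0// divr_ge0// ltW.
have omega0 : 0 <= omega by rewrite addr_ge0// divr_ge0// ltW.
have tau2k : tau ^+ 2 * omega <= T' ^+ 2 * W' * (s * k ^+ 3).
  have -> : T' ^+ 2 * W' * (s * k ^+ 3) = (T' * k) ^+ 2 * (W' * (s * k)) by ring.
  have Tk0 : 0 <= T' * k by rewrite mulr_ge0// ltW.
  by rewrite ler_pM ?exprn_ge0// ler_sqr.
clearbody T' W'.
pose V := N ^+ 2 * (k ^+ 4 * s) / eps ^+ 2.
have V1 : 1 <= V.
  rewrite ler_pdivlMr ?exprn_gt0// mul1r.
  apply: (@le_trans _ _ 1); first by rewrite exprn_ile1// ltW.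
  by rewrite mulr_ege1 ?exprn_ege1// mulr_ege1 ?exprn_ege1.
have V0 : 0 <= V by exact: le_trans V1.
have /andP[tr1 tr2] := truncn_itv V0.
exists (Num.truncn V).+1; split=> //.
  have -> : 2 * N ^+ 2 * (s * k ^+ 4) * eps ^- 2 = V + V by rewrite /V; ring.
  by rewrite -natr1 lerD.
move=> gamma xs ys ws ss g0 gE run; set K := (Num.truncn V).+1 in gE run tr2 *.
have g1 : gamma <= 1.
  rewrite -(@ler_sqr _ gamma 1) ?nnegrE ?(ltW g0)// expr1n.
  have : gamma ^+ 2 <= gamma ^+ 2 * (k ^+ 4 * s * K%:R).
    rewrite ler_peMr ?sqr_ge0//.
    by rewrite mulr_ege1 ?ler1n// mulr_ege1// exprn_ege1.
  by rewrite gE.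
have g01 : 0 <= gamma <= 1 by rewrite g1 ltW.
have Xin := run_in cX g01 Xx0 run.
pose a := lower_error g xs ys; pose d := adjoint_error f g xs ws.
have a0 j : 0 <= a j by exact: enorm_ge0.
have d0 j : 0 <= d j by exact: enorm_ge0.
have gD0 : 0 <= gamma * D by rewrite mulr_ge0// ltW.
have error_coef r : 0 <= r ->
    ibcg_eta c mu L * (Lam * omega) * r <= B * (s * k) * r /\
    ibcg_eta c mu L * (Lam * omega) * r <= 2 / L * (Lam * (W' * (s * k))) * r.
  move=> r0.
  have e3 : ibcg_eta c mu L * (Lam * omega) * r <= 2 / L * (Lam * (W' * (s * k))) * r.
    apply: ler_wpM2r => //; apply: ler_pM => //; first exact: mulr_ge0.
    exact: ler_wpM2l.
  split=> //; apply: le_trans e3 _; rewrite ler_wpM2r//.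
  have -> : 2 / L * (Lam * (W' * (s * k))) = 2 * Lam * W' / L * (s * k) by ring.
  by rewrite ler_wpM2r// (le_trans ler01).
apply: (@averaged_rate R K k s c gamma B eps a d (fun j => ell f g (xs j))
  (fun j => fw_gap X f g (xs j))) => //.
- by rewrite c0 ltW.
- by rewrite e0.
- by rewrite /a /lower_error (run_x0 run) (run_y0 run) (dy0E S) (le_trans (ler_norm _)).
- rewrite /d /adjoint_error (run_x0 run) (run_w0 run).
  apply: le_trans (enormB _ _) _; rewrite (nw0E S).
  have hv : enorm (adjoint_star f g x0) <= omega.
    by apply: le_trans (adjoint_star_norm m0 gh hG Xx0) _; rewrite lerDr.
  have h1 : nw0 <= `|nw0| * (s * k) by apply: le_trans (ler_norm _) _; rewrite ler_peMr.
  have h2 := ler_wpM2r (le_trans ler01 sk1) B8.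
  by rewrite mulrDl in h2; have h3 := le_trans hv omegak; clear - h1 h2 h3; lra.
- have := xstar_min S (Xin K (leqnn K)); have := dl0E S; have := ler_norm dl0.
  rewrite (run_x0 run); move: B9.
  by move: (ell f g _) (ell f g _) (ell f g _) => p q r; clear; lra.
- move=> j jK; have := lower_error_step m0 cX (X_diameter S) gh hCyx g01 Xx0 run jK.
  rewrite -/a -[1 + Lam / mu]/tau -/(a _) -/(a _) => h; apply: le_trans h _.
  have h1 : ibcg_beta mu L * a j <= (1 - k^-1) * a j by rewrite ler_wpM2r// lerBrDl -lerBrDr.
  have h2 : ibcg_beta mu L * (tau * (gamma * D)) <= tau * (gamma * D).
    apply: ler_piMl; first exact: mulr_ge0.
    by rewrite -subr_ge0; apply: le_trans kb; rewrite invr_ge0 ltW.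
  have h3 : tau * (gamma * D) <= T' * k * (gamma * D) by rewrite ler_wpM2r.
  have h4 : T' * D * (k * gamma) <= B * (k * gamma).
    by rewrite ler_wpM2r// mulr_ge0 ?ltW.
  by rewrite mulrDr; clear - h1 h2 h3 h4; lra.
- move=> j jK; have h := adjoint_error_step m0 cX (X_diameter S) fh gh hFyx hFyy hCyx hLyy
    Gs0 hG c01 g01 Xx0 run jK.
  rewrite -/d -/a -/tau -/omega -/(d _) -/(a _) in h.
  have e1' : (1 - c * (1 - ibcg_beta mu L)) * d j <= (1 - c / k) * d j.
    by rewrite ler_wpM2r// lerD2l lerN2 ler_wpM2l// ltW.
  have [e3 _] := error_coef (a j) (a0 j).
  have e4 : tau ^+ 2 * omega * (gamma * D) <= T' ^+ 2 * W' * (s * k ^+ 3) * (gamma * D).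
    by rewrite ler_wpM2r.
  have e5 : T' ^+ 2 * W' * D * (s * k ^+ 3 * gamma) <= B * (s * k ^+ 3 * gamma).
    rewrite ler_wpM2r// mulr_ge0 ?(ltW g0)// mulr_ge0 ?(ltW s0)//.
    by rewrite exprn_ge0// ltW.
  apply: le_trans h _; rewrite -addrA lerD// lerD// (le_trans e4)//.
  have -> : T' ^+ 2 * W' * (s * k ^+ 3) * (gamma * D)
    = T' ^+ 2 * W' * D * (s * k ^+ 3 * gamma) by clear; ring.
  by rewrite -(mulrA B).
- move=> j jK; have h := fw_gap_step m0 cX (X_nonempty S) (X_diameter S) fh gh
    hFxx hFxy hFyx hFyy hCyx hLyx hLyy Gs0 hG g01 Xx0 run jK.
  rewrite -/d -/a -/tau -/omega -/(a _) in h.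
  set b := enorm (ws j.+1 - _) in h.
  have hb : b <= d j + ibcg_eta c mu L * (Lam * omega) * a j.
    apply: le_trans (adjoint_error_half_step m0 cX fh gh hFyx hFyy
      hCyx hLyy hG c01 g01 Xx0 run jK) _.
    rewrite -/d -/a -/omega -/(d j) -/(a j) lerD2r ler_piMl// gerBl mulr_ge0 ?(ltW c0)//.
    by apply: le_trans kb; rewrite invr_ge0 ltW.
  have [_ e3] := error_coef (a j) (a0 j).
  have LD0 : 0 <= Lam * D by rewrite mulr_ge0.
  have e1' : omega * a j <= W' * (s * k) * a j by rewrite ler_wpM2r.
  have e2 : Lam * (omega * a j + b) * D <= Lam * D * (1 + 2 * Lam / L) * W' * (s * k) * a j
      + Lam * D * d j.
    have := ler_wpM2l LD0 (lerD e1' (le_trans hb (lerD (lexx (d j)) e3))).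
    by clear; lra.
  have ska0 : 0 <= s * k * a j by rewrite mulr_ge0// (le_trans ler01).
  have e4 := ler_wpM2r ska0 B5; have e5 := ler_wpM2r (d0 j) B6.
  have e6 : gamma * (2 * (Lam * (omega * a j + b) * D))
      <= gamma * (B * (s * k) * a j + B * d j).
    by rewrite (ler_wpM2l (ltW g0))//; clear - e2 e4 e5; lra.
  have e7 : 2 * Lam * omega * tau ^+ 2 * (gamma * D) ^+ 2
      <= 2 * Lam * (T' ^+ 2 * W' * (s * k ^+ 3)) * (gamma * D) ^+ 2.
    rewrite ler_wpM2r ?sqr_ge0// -(mulrA (2 * Lam)) (mulrC omega) ler_wpM2l//.
    by rewrite mulr_ge0.
  have e8 : 2 * Lam * W' * T' ^+ 2 * D ^+ 2 * (s * k ^+ 3 * gamma ^+ 2)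
      <= B * (s * k ^+ 3 * gamma ^+ 2).
    rewrite ler_wpM2r// mulr_ge0 ?sqr_ge0// mulr_ge0 ?(ltW s0)//.
    by rewrite exprn_ge0// ltW.
  apply: le_trans h _; rewrite -addrA lerD2l lerD//.
  by apply: le_trans e7 _; clear - e8; lra.
- by rewrite -/N -/V ltW.
Qed.

End Complexity.

(** The real powers in both step sizes are negative half-integers, so squaring turns them into the
    integer powers of the step-size equation. *)
Lemma sqr_powR_half (R : realType) (x : R) (n : nat) : 0 <= x ->
  (x `^ (- (n%:R / 2))) ^+ 2 = (x ^+ n)^-1.
Proof.
move=> x0; rewrite -powR_mulrn ?powR_ge0// -powRrM mulNr divfK ?pnatr_eq0//.
by rewrite powRN powR_mulrn.
Qed.

(** Comparison with [xstar], where the norm is [nfy]. Only the motion of y* costs a factor kappa,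
    through |Cyx| / mu; the other terms are enlarged by it since kappa >= 1. *)
Lemma grad_y_ystar_bound (R : realType) n m (X : set 'cV[R]_n)
    (f g : 'cV[R]_n -> 'cV[R]_m -> R)
    (mu L Fxx Fxy Fyx Fyy Cyx Lyx Lyy D dy0 nw0 dl0 nfy : R) x0 y0 xstar x :
  bilevel_setting X f g mu L Fxx Fxy Fyx Fyy Cyx Lyx Lyy D x0 y0 xstar dy0 nw0 dl0 nfy ->
  X x ->
  enorm (grad_y f x (ystar g x))
    <= (`|nfy| + `|Fyx| * `|D| + `|Fyy| * (`|Cyx| / `|L|) * `|D|) * kappa_g mu L.
Proof.
move=> S Xx; have gh := g_ok S; have Xs := xstar_in S.
have mu0 := g_mu_gt0 gh; have muL : mu <= L := mu_le_Lg (dim_y S) gh Xs.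
have L0 : 0 < L by exact: lt_le_trans muL.
have [k1 _ _] := kappa_bounds mu0 muL.
have dx : enorm (x - xstar) <= `|D|.
  exact: le_trans (X_diameter S Xx Xs) (ler_norm _).
have dy := ystar_lipschitz gh (lexx _) Xs Xx.
have df := f_grad_y_lip (f_ok S) (ystar g x) (ystar g xstar) Xx Xs.
have -> : grad_y f x (ystar g x) = grad_y f xstar (ystar g xstar)
    + (grad_y f x (ystar g x) - grad_y f xstar (ystar g xstar)) by rewrite addrC subrK.
apply: le_trans (enormD _ _) _; rewrite (nfyE S) (ger0_norm (ltW L0)).
rewrite mulrDl mulrDl -addrA lerD//.
  by apply: le_trans (ler_norm _) _; rewrite ler_peMr.
apply: le_trans df _; apply: lerD.
  apply: (@le_trans _ _ (`|Fyx| * `|D|)); last by rewrite ler_peMr// mulr_ge0.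
  apply: le_trans (ler_wpM2r (enorm_ge0 _) (ler_norm _)) _.
  by rewrite ler_wpM2l.
apply: le_trans (ler_wpM2r (enorm_ge0 _) (ler_norm _)) _.
have -> : `|Fyy| * (`|Cyx| / L) * `|D| * kappa_g mu L = `|Fyy| * (`|Cyx| / mu * `|D|).
  by rewrite /kappa_g; field; rewrite !gt_eqF.
rewrite ler_wpM2l//; apply: le_trans dy _; rewrite ler_wpM2l// divr_ge0// ltW//.
Qed.

Theorem corollary4p5 (R : realType)
    (c Lg Lfxx Lfxy Lfyx Lfyy Cgyx Lgyx Lgyy D dy0 nw0 dl0 nfy : R)
    (hc : 0 < c < 1) :
  (exists C : R, 0 < C /\
    forall (n m : nat) (X : set 'cV[R]_n) (f g : 'cV[R]_n -> 'cV[R]_m -> R)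
      (mu : R) (x0 : 'cV[R]_n) (y0 : 'cV[R]_m) (xstar : 'cV[R]_n),
    bilevel_setting X f g mu Lg Lfxx Lfxy Lfyx Lfyy Cgyx Lgyx Lgyy D
      x0 y0 xstar dy0 nw0 dl0 nfy ->
    forall eps : R, 0 < eps <= 1 ->
    exists K : nat, [/\ (0 < K)%N,
      K%:R <= C * kappa_g mu Lg ^+ 5 * eps ^- 2 &
      forall (xs : nat -> 'cV[R]_n) (ys ws : nat -> 'cV[R]_m)
        (ss : nat -> 'cV[R]_n),
      ibcg_run X f g
        (fun=> kappa_g mu Lg `^ (- (5 / 2)) * K%:R `^ (- (1 / 2)))
        (fun=> ibcg_eta c mu Lg) (ibcg_alpha mu Lg) x0 y0 K xs ys ws ss ->
      exists kstar : nat, (kstar < K)%N /\ fw_gap X f g (xs kstar) <= eps])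
  /\
  (forall M : R, 0 <= M ->
    exists C : R, 0 < C /\
    forall (n m : nat) (X : set 'cV[R]_n) (f g : 'cV[R]_n -> 'cV[R]_m -> R)
      (mu : R) (x0 : 'cV[R]_n) (y0 : 'cV[R]_m) (xstar : 'cV[R]_n),
    bilevel_setting X f g mu Lg Lfxx Lfxy Lfyx Lfyy Cgyx Lgyx Lgyy D
      x0 y0 xstar dy0 nw0 dl0 nfy ->
    (forall x y, X x -> enorm (grad_y f x y) <= M) ->
    forall eps : R, 0 < eps <= 1 ->
    exists K : nat, [/\ (0 < K)%N,
      K%:R <= C * kappa_g mu Lg ^+ 4 * eps ^- 2 &
      forall (xs : nat -> 'cV[R]_n) (ys ws : nat -> 'cV[R]_m)
        (ss : nat -> 'cV[R]_n),
      ibcg_run X f g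
        (fun=> kappa_g mu Lg `^ (- 2) * K%:R `^ (- (1 / 2)))
        (fun=> ibcg_eta c mu Lg) (ibcg_alpha mu Lg) x0 y0 K xs ys ws ss ->
      exists kstar : nat, (kstar < K)%N /\ fw_gap X f g (xs kstar) <= eps]).
Proof.
split=> [|M M0].
  pose G := `|nfy| + `|Lfyx| * `|D| + `|Lfyy| * (`|Cgyx| / `|Lg|) * `|D|.
  have G0 : 0 <= G by rewrite !addr_ge0// !mulr_ge0// invr_ge0.
  have [C [C0 hC]] := ibcg_complexity Lg Lfxx Lfxy Lfyx Lfyy Cgyx Lgyx Lgyy D dy0 nw0 dl0
    nfy hc G0.
  exists C; split=> // n m X f g mu x0 y0 xstar S eps eps01.
  have gh := g_ok S; have mu0 := g_mu_gt0 gh.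
  have [k1 _ _] := kappa_bounds mu0 (mu_le_Lg (dim_y S) gh (x0_in S)).
  set k := kappa_g mu Lg in k1 *; have k0 : 0 < k by exact: lt_le_trans k1.
  (* Here s = k, because [grad_y_ystar_bound] grows linearly in kappa; this makes s k^4 equal to
     kappa^5. *)
  have [K [K0 hK hrun]] := hC _ _ _ _ _ _ _ _ _ S k k1
    (fun x => grad_y_ystar_bound S) eps eps01.
  exists K; split=> //.
  move=> xs ys ws ss run; apply: (hrun _ xs ys ws ss _ _ run).
    by rewrite mulr_gt0 ?powR_gt0 ?ltr0n.
  have Kr : 0 < K%:R :> R by rewrite ltr0n.
  rewrite exprMn (sqr_powR_half 5 (ltW k0)) (sqr_powR_half 1 (ltW Kr)) -/k.
  by field; rewrite !gt_eqF.
have [C [C0 hC]] := ibcg_complexity Lg Lfxx Lfxy Lfyx Lfyy Cgyx Lgyx Lgyy D dy0 nw0 dl0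
  nfy hc M0.
exists C; split=> // n m X f g mu x0 y0 xstar S hM eps eps01.
have gh := g_ok S; have mu0 := g_mu_gt0 gh.
have [k1 _ _] := kappa_bounds mu0 (mu_le_Lg (dim_y S) gh (x0_in S)).
set k := kappa_g mu Lg in k1 *; have k0 : 0 < k by exact: lt_le_trans k1.
have hM1 x : X x -> enorm (grad_y f x (ystar g x)) <= M * 1 by rewrite mulr1; exact: hM.
(* A bound on [grad_y f] free of kappa allows s = 1, which saves one power of kappa. *)
have [K [K0 hK hrun]] := hC _ _ _ _ _ _ _ _ _ S 1 (lexx 1) hM1 eps eps01.
exists K; split=> //; first by rewrite mul1r in hK.
move=> xs ys ws ss run; apply: (hrun _ xs ys ws ss _ _ run).
  by rewrite mulr_gt0 ?powR_gt0 ?ltr0n.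
have Kr : 0 < K%:R :> R by rewrite ltr0n.
have e2 : - 2 = - (4%:R / 2) :> R by field.
rewrite exprMn e2 (sqr_powR_half 4 (ltW k0)) (sqr_powR_half 1 (ltW Kr)) -/k.
by field; rewrite !gt_eqF.
Qed.
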